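(* Let $Y\ge 0$ be a non-negative random variable in the centered Feller class $\mathcal{F}_c$, let $Y_1,Y_2,\dots$ be i.i.d. copies of $Y$, and let $a_n>0$, $a_n\to\infty$, be norming constants such that every subsequence of $\{n\}$ contains a further subsequence $\{n'\}$ along which $a_{n'}^{-1}\sum_{i=1}^{n'}Y_i$ converges in distribution to a non-degenerate random variable. Then every subsequential limit law $V$ of $a_n^{-1}\sum_{i=1}^nY_i$ has characteristic function of the form $$Ee^{\mathrm{i}uV}=\exp\left\{\int_0^\infty\left(e^{\mathrm{i}uy}-1\right)\Lambda(\mathrm{d}y)\right\},\quad u\in\mathbb{R},$$ where $\Lambda$ is a Lévy measure concentrated on $(0,\infty)$ satisfying $\int_0^1s\,\Lambda(\mathrm{d}s)<\infty$.
   Context: Feller class: a random variable $Y$ is in the Feller class $\mathcal{F}$ if there exist norming constants $a_n>0$ with $a_n\to\infty$ and centering constants $b_n\in\mathbb{R}$ such that, for $Y_1,Y_2,\dots$ i.i.d. copies of $Y$, every subsequence of $\{n\}$ contains a further subsequence $\{n'\}$ along which $a_{n'}^{-1}\{\sum_{i=1}^{n'}Y_i-b_{n'}\}$ converges in distribution to some non-degenerate random variable (which may depend on the subsequence). $Y$ is in the centered Feller class, $Y\in\mathcal{F}_c$, if this holds with $b_n=0$ for all $n\ge1$. A subsequential limit law is the limit in distribution along some subsequence of $\{n\}$. *)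

(* Defs.v *)
From HB Require Import structures.
From mathcomp Require Import all_boot all_order all_algebra.
From mathcomp Require Import all_classical all_reals all_analysis.
From mathcomp Require Import measurable_realfun.
From mathcomp Require Export complex.
Import Order.TTheory GRing.Theory Num.Theory.
Import numFieldNormedType.Exports.

Set Implicit Arguments.
Unset Strict Implicit.
Unset Printing Implicit Defensive.

Local Open Scope classical_set_scope.
Local Open Scope ring_scope.
Local Open Scope complex_scope.

Definition independent_RVs (R : realType) (d : measure_display)
    (T : measurableType d) (P : probability T R) (Ys : nat -> {RV P >-> R}) :
    Prop :=
  forall (J : seq nat) (A : nat -> set R), uniq J ->
    (forall i, measurable (A i)) ->
    (P (\bigcap_(i in [set` J]) (Ys i @^-1` A i)) =
     \prod_(i <- J) P (Ys i @^-1` A i))%E.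

(* [Y] may live on another probability space than the sequence [Ys]. *)
Definition iid_copies (R : realType) (d0 : measure_display)
    (T0 : measurableType d0) (P0 : probability T0 R) (Y : {RV P0 >-> R})
    (d : measure_display) (T : measurableType d) (P : probability T R)
    (Ys : nat -> {RV P >-> R}) : Prop :=
  independent_RVs Ys /\
  forall (i : nat) (A : set R), measurable A ->
    distribution P (Ys i) A = distribution P0 Y A.

(* Weak convergence: convergence of the expectations of all bounded continuous
   functions. The limit may live on another probability space. *)
Definition cvg_in_distribution (R : realType) (d : measure_display)
    (T : measurableType d) (P : probability T R) (X : nat -> {RV P >-> R})
    (d' : measure_display) (T' : measurableType d') (Q : probability T' R)
    (V : {RV Q >-> R}) : Prop :=
  forall f : R -> R, continuous f -> (exists M : R, forall x, `|f x| <= M) ->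
    ('E_P[f \o X n] @[n --> \oo] --> 'E_Q[f \o V])%E.

Definition nondegenerate (R : realType) (d : measure_display)
    (T : measurableType d) (P : probability T R) (V : {RV P >-> R}) : Prop :=
  ~ exists c : R, {ae P, forall t, V t = c}.

Definition strictly_increasing (phi : nat -> nat) : Prop :=
  {homo phi : m n / (m < n)%N}.

(* With [Ys] indexed from 0, the term of rank [n] is
   (Y_1 + ... + Y_n - b_n) / a_n; the value at [n = 0] plays no role. *)
Definition normalized_sum_fun (R : realType) (T : Type) (Ys : nat -> T -> R)
    (a b : nat -> R) (n : nat) (t : T) : R :=
  (a n)^-1 * (\sum_(i < n) Ys i t - b n).

Lemma measurable_normalized_sum (R : realType) (d : measure_display)
    (T : measurableType d) (P : probability T R) (Ys : nat -> {RV P >-> R})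
    (a b : nat -> R) (n : nat) :
  measurable_fun [set: T] (normalized_sum_fun Ys a b n).
Proof.
apply: measurable_funM => //; apply: measurable_funB => //.
by apply: measurable_sum => i.
Qed.

HB.instance Definition _ (R : realType) (d : measure_display)
    (T : measurableType d) (P : probability T R) (Ys : nat -> {RV P >-> R})
    (a b : nat -> R) (n : nat) :=
  isMeasurableFun.Build _ _ _ _ (normalized_sum_fun Ys a b n)
    (measurable_normalized_sum Ys a b n).

Definition normalized_sum (R : realType) (d : measure_display)
    (T : measurableType d) (P : probability T R) (Ys : nat -> {RV P >-> R})
    (a b : nat -> R) (n : nat) : {RV P >-> R} :=
  normalized_sum_fun Ys a b n.

Definition is_subsequential_limit (R : realType) (d : measure_display)
    (T : measurableType d) (P : probability T R) (X : nat -> {RV P >-> R})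
    (d' : measure_display) (T' : measurableType d') (Q : probability T' R)
    (V : {RV Q >-> R}) : Prop :=
  exists phi : nat -> nat, strictly_increasing phi /\
    cvg_in_distribution (fun k => X (phi k)) V.

Definition norming (R : realType) (a : nat -> R) : Prop :=
  (forall n, (0 < n)%N -> 0 < a n) /\ a @ \oo --> +oo.

Definition subsequentially_nondegenerate (R : realType) (d : measure_display)
    (T : measurableType d) (P : probability T R) (X : nat -> {RV P >-> R}) :
    Prop :=
  forall phi : nat -> nat, strictly_increasing phi ->
    exists psi : nat -> nat, strictly_increasing psi /\
    exists (d' : measure_display) (T' : measurableType d')
           (Q : probability T' R) (W : {RV Q >-> R}),
      nondegenerate W /\
      cvg_in_distribution (fun k => X (phi (psi k))) W.

Definition feller_with (R : realType) (d0 : measure_display)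
    (T0 : measurableType d0) (P0 : probability T0 R) (Y : {RV P0 >-> R})
    (a b : nat -> R) : Prop :=
  norming a /\
  forall (d : measure_display) (T : measurableType d) (P : probability T R)
         (Ys : nat -> {RV P >-> R}),
    iid_copies Y Ys -> subsequentially_nondegenerate (normalized_sum Ys a b).

Definition feller_class (R : realType) (d0 : measure_display)
    (T0 : measurableType d0) (P0 : probability T0 R) (Y : {RV P0 >-> R}) :
    Prop :=
  exists a b : nat -> R, feller_with Y a b.

Definition centered_feller_class (R : realType) (d0 : measure_display)
    (T0 : measurableType d0) (P0 : probability T0 R) (Y : {RV P0 >-> R}) :
    Prop :=
  exists a : nat -> R, feller_with Y a (fun=> 0).

Definition expC (R : realType) (z : R[i]) : R[i] :=
  (expR (complex.Re z))%:C *
  (cos (complex.Im z) +i* sin (complex.Im z)).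

(* [Rintegral] returns a default value on non-integrable functions; the
   definition is meant for integrable [f]. *)
Definition Cintegral (R : realType) (d : measure_display)
    (T : measurableType d) (mu : {measure set T -> \bar R}) (D : set T)
    (f : T -> R[i]) : R[i] :=
  (\int[mu]_(x in D) complex.Re (f x)) +i*
  (\int[mu]_(x in D) complex.Im (f x)).

Definition char_fun (R : realType) (d : measure_display)
    (T : measurableType d) (P : probability T R) (V : {RV P >-> R}) (u : R) :
    R[i] :=
  Cintegral P setT (fun t => expC (0 +i* (u * V t))).

Definition levy_measure (R : realType) (L : {measure set R -> \bar R}) : Prop :=
  L [set 0] = 0%E /\
  (\int[L]_x (Num.min 1 (x ^+ 2))%:E < +oo)%E.

(* Main.v *)
From HB Require Import structures.
Require Import Defs.
From mathcomp Require Import all_boot all_order all_algebra.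
From mathcomp Require Import all_classical all_reals all_analysis.
From mathcomp Require Import measurable_realfun lra ring.
Import Order.TTheory GRing.Theory Num.Theory.
Import numFieldNormedType.Exports ComplexField.Normc.

Local Open Scope classical_set_scope.
Local Open Scope ring_scope.
Local Open Scope complex_scope.

Set Implicit Arguments.
Unset Strict Implicit.
Unset Printing Implicit Defensive.

(** Write [h s = E (1 - exp (- s Y))] and, along a subsequence on which the
    normalized sums converge to [V], [psi s = - ln (E (exp (- s V)))], so that
    [n h (s / a_n)] tends to [psi s].  Let [G_n] be the generalized inverse of the
    tail [y |-> n P (Y > a_n y)]: it is nonincreasing and
    [n E (f (Y / a_n))] is the Lebesgue integral of [f \o G_n] over the positive
    half-line whenever [f 0 = 0].  Since [psi] vanishes at [0], the [G_n] are bounded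
    at each [t > 0], hence they have a pointwise limit [G] along an ultrafilter, and
    Riemann sums show that the integrals of [f \o G_n] over a compact interval
    converge to that of [f \o G] for every Lipschitz [f].  No mass (drift) escapes
    to [t = +oo] because [psi s / s] tends to [0] as [s] grows: otherwise [h] would
    be nearly linear on a long range of scales, and this range contains [1 / a_m]
    for some large [m], so that [m h (2 / a_m)] would be close to
    [2 m h (1 / a_m)]; every subsequential limit being nondegenerate, strict
    convexity forbids this.  The Levy measure is the image of Lebesgue measure
    under [G]. *)

(** * Generalized inverses of tails *)

(** The scaled tail measures have mass of order n, so weak compactness of probability laws does not
    apply to them. Carried by [G_n] on one fixed Lebesgue space, they converge as monotone functions
    do, pointwise; tiny jumps sit near t = +oo and large ones near t = 0. The weight [satexp] y = 1
    - e^-y, of the order of min (1, y), links everything: integrated along s [G_n] it gives n h (s /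
    a_n), and it dominates every bounded Lipschitz f with f 0 = 0, in particular cos (u y) - 1 and
    sin (u y). Near t = 0 boundedness of f suffices, so the obstacle is t = +oo: a drift is a limit
    of many tiny jumps, and convergence to [V] along its own subsequence cannot exclude it. It is
    excluded along another one: for a small c, the scale [a_m] of an index m close to c n is
    confined to a fixed window relative to [a_n]. Hence the recourse to nondegeneracy along all
    subsequences. Limits known along [\oo] persist along a finer ultrafilter, so the [G_n] need not
    converge along any sequence. *)

(* Junk value 0 on the nonpositive half-line: integrals of [f \o G] over the
   whole line then only see [t > 0] as soon as [f 0 = 0]. *)
Definition nonincreasing_profile (R : realType) (G : R -> R) : Prop :=
  [/\ forall t, t <= 0 -> G t = 0,
      forall t, 0 <= G t
    & forall s t, 0 < s -> s <= t -> G t <= G s].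

Lemma measurable_nonincreasing_profile (R : realType) (G : R -> R) :
  nonincreasing_profile G -> measurable_fun setT G.
Proof.
move=> [G0 G_ge0 G_ni].
apply: (measurability (@RGenOInfty.G R)) => [|/= _ [_] [r] -> <-].
  exact: RGenOInfty.measurableE.
rewrite setTI; have [r0|r0] := ltP r 0.
  rewrite [X in measurable X](_ : _ = setT)//; apply/seteqP; split => // t _ /=.
  by rewrite in_itv/= andbT (lt_le_trans r0).
apply: is_interval_measurable => s t/=.
rewrite !in_itv/= !andbT => Gs Gt u /andP[su ut].
have s0 : 0 < s.
  by rewrite ltNge; apply/negP => /G0 Gs0; move: Gs; rewrite Gs0 ltNge r0.
by rewrite in_itv/= andbT (lt_le_trans Gt)// G_ni// (lt_le_trans s0).
Qed.

Lemma finite_measure_eq_rays (R : realType)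
    (m1 m2 : {measure set R -> \bar R}) :
  (m1 setT < +oo)%E ->
  (forall x, m1 `]x, +oo[%classic = m2 `]x, +oo[%classic) ->
  forall A, measurable A -> m1 A = m2 A.
Proof.
move=> m1_fin m12; pose g k := `](- k%:R : R), +oo[%classic.
apply: (measure_unique (@RGenOInfty.G R) g).
- exact: RGenOInfty.measurableE.
- move=> _ _ [x ->] [y ->]; exists (Num.max x y).
  by apply/seteqP; split => z /=; rewrite !in_itv/= !andbT gt_max;
    [move=> [-> ->]|move=> /andP].
- by move=> i; exists (- i%:R).
- apply/seteqP; split => // x _; exists (Num.truncn `|x|).+1 => //.
  rewrite /g /= in_itv/= andbT ltrNl.
  by apply: le_lt_trans (truncnS_gt _); rewrite -normrN ler_norm.
- by move=> _ [x ->]; exact: m12.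
- move=> k; apply: le_lt_trans m1_fin; apply: le_measure => //; rewrite inE//; exact: measurable_itv.
Qed.

(** [G t] is the infimum of the levels y whose tail is at most t, so that for t > 0 and y >= 0,
    [G t <= y] is equivalent to [T y <= t]; the set where y < G is then the interval []0, T y[]. *)
Lemma tail_inverse (R : realType) (m : {measure set R -> \bar R}) :
  (m setT < +oo)%E ->
  exists2 G : R -> R, nonincreasing_profile G &
    forall y, 0 <= y -> lebesgue_measure [set t | y < G t] = m `]y, +oo[%classic.
Proof.
move=> m_fin; pose T y := m `]y, +oo[%classic.
have T_fin y : T y \is a fin_num.
  rewrite ge0_fin_numE ?measure_ge0//; apply: le_lt_trans m_fin.
  by apply: le_measure => //; rewrite inE//.
have T_ni x y : x <= y -> (T y <= T x)%E.
  move=> xy; apply: le_measure => //; rewrite ?inE//.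
  by move=> z /=; rewrite !in_itv/= !andbT; apply: le_lt_trans.
pose E t := [set y : R | 0 <= y /\ (T y <= t%:E)%E].
(* Right continuity of the tail, since the rays from y + 1 / (k + 1) increase to the ray from y. It
   is what makes the infimum defining [G] attained. *)
have T_right y t : (forall z, y < z -> (T z <= t%:E)%E) -> (T y <= t%:E)%E.
  move=> Tz; pose F k := `](y + k.+1%:R^-1 : R), +oo[%classic.
  have F_nd : nondecreasing_seq F.
    move=> i j ij; apply/subsetPset => z; rewrite /F /= !in_itv/= !andbT.
    by apply: le_lt_trans; rewrite lerD2l lef_pV2 ?posrE// ler_nat.
  have UF : \bigcup_k F k = `]y, +oo[%classic.
    apply/seteqP; split => z /=; rewrite ?in_itv/= ?andbT.
      move=> [k _]; rewrite /F /= in_itv/= andbT; apply: le_lt_trans.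
      by rewrite lerDl.
    move=> yz; have zy0 : 0 < z - y by rewrite subr_gt0.
    exists (Num.truncn (z - y)^-1) => //; rewrite /F /= in_itv/= andbT.
    rewrite -ltrBrDl invf_plt ?posrE//.
    by apply: truncnS_gt.
  have cF : m (F n) @[n --> \oo] --> m (\bigcup_k F k).
    apply: nondecreasing_cvg_mu => //; last by rewrite UF.
    by move=> i; exact: measurable_itv.
  rewrite /T -UF -(cvg_lim _ cF)//; apply: lime_le; first by apply/cvg_ex; eexists; exact: cF.
  by apply: nearW => n; apply: Tz; rewrite ltrDl.
(* Finite mass lets the tail fall below t, as the rays from k decrease to the empty set; [inf] is
   thus never taken over an empty set. *)
have E_neq0 t : 0 < t -> E t !=set0.
  move=> t0; pose F k := `](k%:R : R), +oo[%classic.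
  have cF : m (F n) @[n --> \oo] --> m (\bigcap_k F k).
    apply: nonincreasing_cvg_mu => //.
    - apply: le_lt_trans m_fin; apply: le_measure => //; rewrite inE//.
      exact: measurable_itv.
    - by move=> i; exact: measurable_itv.
    - by apply: bigcapT_measurable => i; exact: measurable_itv.
    - move=> i j ij; apply/subsetPset => z; rewrite /F /= !in_itv/= !andbT.
      by apply: le_lt_trans; rewrite ler_nat.
  have F0 : \bigcap_k F k = set0.
    apply/seteqP; split => // z /(_ (Num.truncn `|z|).+1 I).
    rewrite /F /= in_itv/= andbT => zz; have := truncnS_gt `|z|.
    by move=> h; have := lt_trans h zz; rewrite ltNge ler_norm.
  rewrite F0 measure0 in cF.
  have /cF : nbhs (0%E : \bar R) [set x | (x < t%:E)%E].
    by apply: open_ereal_lt'; rewrite lte_fin.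
  move=> [k _ /(_ k (leqnn _)) /= /ltW Fk].
  by exists k%:R; split.
have Elb t : has_lbound (E t) by exists 0 => y [].
pose G t := if 0 < t then inf (E t) else 0.
have G_le t y : 0 < t -> 0 <= y -> (G t <= y) = (T y <= t%:E)%E.
  move=> t0 y0; rewrite /G t0; apply/idP/idP => [Gy|Ty]; last first.
    by apply: ge_inf.
  apply: T_right => z yz.
  have Eit : has_inf (E t) by split => //; exact: E_neq0.
  have /(inf_adherent)/(_ Eit)[w [w0 Tw]] : 0 < z - inf (E t).
    by rewrite subr_gt0 (le_lt_trans Gy).
  rewrite subrKC => wz; apply: le_trans Tw.
  by apply/T_ni/ltW.
exists G.
  split => [t t0|t|s t s0 st].
  - by rewrite /G ltNge t0.
  - rewrite /G; case: ifPn => // t0.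
    by apply: lb_le_inf => [|y []]//; exact: E_neq0.
  - have t0 := lt_le_trans s0 st.
    rewrite /G s0 t0; apply: lb_le_inf; first exact: E_neq0.
    move=> y [y0 Ty]; apply: ge_inf => //; split => //.
    by rewrite (le_trans Ty)// lee_fin.
move=> y y0; rewrite (_ : [set t | _] = `]0, fine (T y)[%classic).
  rewrite lebesgue_measure_itv/= lte_fin; case: ifPn => [Ty0|].
    by rewrite oppr0 adde0 fineK.
  rewrite -leNgt => Ty0; apply/esym/eqP.
  have : (T y <= 0)%E by rewrite -(fineK (T_fin y)) lee_fin.
  by rewrite measure_le0.
apply/seteqP; split => t /=; rewrite in_itv/=.
  move=> yG; have t0 : 0 < t.
    by move: yG; rewrite /G; case: ifPn => // _ /(le_lt_trans y0); rewrite ltxx.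
  by rewrite t0/= -lte_fin fineK// ltNge -G_le// -ltNge.
by move=> /andP[t0 tT]; rewrite ltNge G_le// -ltNge -(fineK (T_fin y)) lte_fin.
Qed.

(** As f 0 = 0, the points where [G] vanishes contribute nothing. Positive and negative parts are
    treated separately, so the identity holds for every measurable f, integrable or not. *)
Lemma integral_comp_profile (R : realType) (G : R -> R)
    (L : {measure set R -> \bar R}) (f : R -> \bar R) :
  nonincreasing_profile G ->
  (forall A : set R, measurable A -> A `<=` `]0%R, +oo[%classic ->
    L A = lebesgue_measure (G @^-1` A)) ->
  measurable_fun setT f -> f 0 = 0%E ->
  (\int[lebesgue_measure]_t f (G t) = \int[L]_(y in `]0%R, +oo[) f y)%E.
Proof.
move=> pG LE; have mG := measurable_nonincreasing_profile pG.
have [_ G_ge0 _] := pG.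
have nneg (g : R -> \bar R) : measurable_fun setT g -> g 0 = 0%E ->
    (forall x, 0 <= g x)%E ->
  (\int[lebesgue_measure]_t g (G t) = \int[L]_(y in `]0%R, +oo[) g y)%E.
  move=> mg g0 g_ge0.
  have -> : (\int[L]_(y in `]0%R, +oo[) g y =
      \int[pushforward lebesgue_measure G]_(y in `]0%R, +oo[) g y)%E.
    by apply: eq_measure_integral => A mA AD; exact: LE.
  rewrite ge0_integral_pushforward//=; last exact: measurable_funTS.
  rewrite integral_mkcond/= [RHS]integral_mkcond; apply: eq_integral => t _.
  rewrite /patch/= mem_setT; case: ifPn => //.
  rewrite notin_setE/= in_itv/= andbT => /negP; rewrite -leNgt => Gt0.
  by rewrite (_ : G t = 0) ?g0//; apply/eqP; rewrite eq_le Gt0 G_ge0.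
move=> mf f0; rewrite integralE [RHS]integralE; congr (_ - _)%E.
- rewrite -(nneg (f^\+)%E)//; last by rewrite funeposE f0 maxxx.
    by apply: eq_integral => t _; rewrite !funeposE.
  exact: measurable_funepos.
- rewrite -(nneg (f^\-)%E)//; last by rewrite funenegE f0 oppe0 maxxx.
    by apply: eq_integral => t _; rewrite !funenegE.
  exact: measurable_funeneg.
Qed.

(** The image of Lebesgue measure under [G] has infinite mass at 0, because [G] vanishes for t <= 0;
    the two measures are therefore compared after restriction to the open half-line, where they are
    finite and agree on rays. *)
Lemma integral_tail_inverse (R : realType) (m : {measure set R -> \bar R})
    (G : R -> R) :
  (m setT < +oo)%E -> nonincreasing_profile G ->
  (forall y, 0 <= y ->
    lebesgue_measure [set t | y < G t] = m `]y, +oo[%classic) ->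
  forall f : R -> \bar R, measurable_fun setT f -> f 0 = 0%E ->
  (\int[lebesgue_measure]_t f (G t) = \int[m]_(y in `]0%R, +oo[) f y)%E.
Proof.
move=> m_fin pG GE; have mG := measurable_nonincreasing_profile pG.
have mD : measurable (`]0, +oo[%classic : set R) by [].
pose m1 : {measure set R -> \bar R} := mrestr (pushforward lebesgue_measure G) mD.
pose m2 : {measure set R -> \bar R} := mrestr m mD.
have m12 A : measurable A -> m2 A = m1 mG A.
  apply: finite_measure_eq_rays.
    rewrite /m2 /= /mrestr; apply: le_lt_trans m_fin.
    by apply: le_measure => //; rewrite inE ?setTI.
  move=> x; rewrite /m1 /m2 /= /mrestr /pushforward.
  have -> : `]x, +oo[%classic `&` `]0, +oo[%classic = `]Num.max x 0, +oo[%classic.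
    by apply/seteqP; split => z /=; rewrite !in_itv/= !andbT gt_max;
      [move=> [-> ->]|move=> /andP].
  rewrite -GE ?le_max ?lexx ?orbT//; congr (lebesgue_measure _).
  by apply/seteqP; split => t /=; rewrite in_itv/= andbT.
move=> f mf f0; apply: integral_comp_profile => // A mA AD.
by move: (m12 A mA); rewrite /m1 /m2 /= /mrestr (setIidl AD).
Qed.

(** Restriction discards the infinite atom of the image measure at 0. Applied to the limit profile,
    this yields the Levy measure. *)
Lemma measure_of_profile (R : realType) (G : R -> R) :
  nonincreasing_profile G ->
  exists2 L : {measure set R -> \bar R}, L (~` `]0%R, +oo[%classic) = 0%E &
    forall f : R -> \bar R, measurable_fun setT f -> f 0 = 0%E ->
    (\int[lebesgue_measure]_t f (G t) = \int[L]_(y in `]0%R, +oo[) f y)%E.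
Proof.
move=> pG; have mG := measurable_nonincreasing_profile pG.
have mD : measurable (`]0, +oo[%classic : set R) by [].
pose L0 : {measure set R -> \bar R} := mrestr (pushforward lebesgue_measure G) mD.
exists (L0 mG); first by rewrite /L0 /= /mrestr setICl measure0.
move=> f mf f0; apply: integral_comp_profile => // A mA AD.
by rewrite /L0 /= /mrestr (setIidl AD).
Qed.

(** * Independence *)

Lemma bounded_integrable (R : realType) (d : measure_display)
    (T : measurableType d) (mu : {measure set T -> \bar R}) (f : T -> R)
    (M : R) :
  (mu setT < +oo)%E -> measurable_fun setT f -> (forall x, `|f x| <= M) ->
  mu.-integrable setT (EFin \o f).
Proof.
move=> mu_fin mf fM; apply: measurable_bounded_integrable => //.
exists M; split; first by rewrite num_real.
by move=> x Mx y _; apply: le_trans (fM y) (ltW Mx).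
Qed.

(** The joint law is the product of the two laws, by uniqueness of the product measure given its
    values on rectangles; Fubini's theorem then separates the factors. *)
Lemma Rintegral_mul_indep (R : realType) (d : measure_display)
    (T : measurableType d) (P : probability T R) (X Y : {RV P >-> R})
    (f g : R -> R) (Mf Mg : R) :
  (forall A B, measurable A -> measurable B ->
    P (X @^-1` A `&` Y @^-1` B) = (P (X @^-1` A) * P (Y @^-1` B))%E) ->
  measurable_fun setT f -> measurable_fun setT g ->
  (forall x, `|f x| <= Mf) -> (forall x, `|g x| <= Mg) ->
  \int[P]_t (f (X t) * g (Y t)) = (\int[P]_t f (X t)) * (\int[P]_t g (Y t)).
Proof.
move=> XY mf mg fM gM.
have mX : measurable_fun setT X by [].
have mY : measurable_fun setT Y by [].
pose XYp (t : T) : R * R := (X t, Y t).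
have mXY : measurable_fun setT XYp by exact: measurable_fun_pair.
pose h (z : R * R) := f z.1 * g z.2.
have mh : measurable_fun setT h.
  by apply: measurable_funM; apply: measurableT_comp.
have hM z : `|h z| <= Mf * Mg by rewrite normrM ler_pM.
pose mu1 : probability R R := distribution P X.
pose mu2 : probability R R := distribution P Y.
have joint A : measurable A -> (mu1 \x mu2)%E A = pushforward P XYp A.
  by apply: (@product_measure_unique _ _ _ _ _ mu1 mu2) => {}A B mA mB; rewrite -XY.
have inth : (mu1 \x mu2)%E.-integrable setT (EFin \o h).
  apply: (bounded_integrable _ mh hM).
  rewrite [X in (X < _)%E](joint setT measurableT).
  by rewrite /pushforward preimage_setT probability_setT ltry.
have intX : P.-integrable setT (EFin \o (f \o X)).
  by apply: (@bounded_integrable _ _ _ _ _ Mf) => //=;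
     [rewrite probability_setT ltry|exact: measurableT_comp].
have intf : mu1.-integrable setT (EFin \o f).
  by apply: (@bounded_integrable _ _ _ _ _ Mf) => //=; rewrite probability_setT ltry.
have intg : mu2.-integrable setT (EFin \o g).
  by apply: (@bounded_integrable _ _ _ _ _ Mg) => //=; rewrite probability_setT ltry.
have intXY : P.-integrable setT (EFin \o (h \o XYp)).
  by apply: (@bounded_integrable _ _ _ _ _ (Mf * Mg)) => //=;
     [rewrite probability_setT ltry|exact: measurableT_comp].
rewrite /Rintegral.
have -> : (\int[P]_t (f (X t) * g (Y t))%:E = \int[(mu1 \x mu2)%E]_z (h z)%:E)%E.
  rewrite (eq_measure_integral (pushforward P XYp)); last by move=> A mA _; exact: joint.
  by rewrite integral_pushforward//=; exact/measurable_EFinP.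
rewrite -(integral12_prod_meas1 inth).
rewrite /fubini_F.
have -> : (\int[P]_t (f (X t))%:E = \int[mu1]_x (f x)%:E)%E.
  by rewrite integral_distribution//; exact/measurable_EFinP.
have -> : (\int[P]_t (g (Y t))%:E = \int[mu2]_x (g x)%:E)%E.
  rewrite integral_distribution//; first exact/measurable_EFinP.
  by apply: (@bounded_integrable _ _ _ _ _ Mg) => //=;
     [rewrite probability_setT ltry|exact: measurableT_comp].
rewrite (eq_integral (fun x => ((fine (\int[mu2]_y (g y)%:E))%:E * (f x)%:E)%E)).
  rewrite integralZl// fineM//=; first by rewrite mulrC.
  exact: integrable_fin_num.
move=> x _; transitivity (\int[mu2]_y ((f x)%:E * (EFin \o g) y))%E.
  by apply: eq_integral => y _; rewrite -EFinM.
by rewrite integralZl// muleC fineK//; exact: integrable_fin_num.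
Qed.

(** With B fixed, both sides are finite measures of the left event. They agree on cylinders over the
    first n variables, a family stable under intersection, hence on the sigma-algebra it generates,
    for which the partial sum is measurable. *)
Lemma indep_partial_sum (R : realType) (d : measure_display)
    (T : measurableType d) (P : probability T R) (Ys : nat -> {RV P >-> R})
    (n : nat) (A B : set R) :
  independent_RVs Ys -> measurable A -> measurable B ->
  P ((fun t => (\sum_(i < n) Ys i t)%R) @^-1` A `&` Ys n @^-1` B) =
  (P ((fun t => (\sum_(i < n) Ys i t)%R) @^-1` A) * P (Ys n @^-1` B))%E.
Proof.
move=> indep mA mB.
have mpre i C : measurable C -> measurable (Ys i @^-1` C).
  by move=> mC; rewrite -[X in measurable X]setTI; exact: measurable_funPT.
pose G := [set D | exists2 C : nat -> set R, forall i, measurable (C i) &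
  D = \bigcap_(i in [set` iota 0 n]) (Ys i @^-1` C i)].
have mG : G `<=` measurable.
  move=> _ [C mC ->]; rewrite bigcap_seq; apply: bigsetI_measurable => i _.
  exact: mpre.
pose m1 : {measure set T -> \bar R} := mrestr P (mpre n B mB).
have Bfin : P (Ys n @^-1` B) \is a fin_num by apply: fin_num_measure; exact: (mpre n B mB).
pose b : {nonneg R} := NngNum (fine_ge0 (measure_ge0 P (Ys n @^-1` B))).
have bE : (b%:num)%:E = P (Ys n @^-1` B) by rewrite /b/= fineK.
pose m2 : {measure set T -> \bar R} := mscale b P.
have m12 D : <<s G >> D -> m1 D = m2 D.
  apply: (g_sigma_algebra_measure_unique G mG (fun=> setT)).
  - move=> _; exists (fun=> setT) => //.
    by apply/seteqP; split => // t _ i _.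
  - by apply/seteqP; split => // t _; exists 0%N.
  - move=> _ _ [C mC ->] [C' mC' ->]; exists (fun i => C i `&` C' i).
      by move=> i; exact: measurableI.
    by rewrite -bigcapI.
  - move=> _ [C mC ->].
    rewrite /m1 /m2 /= /mrestr /mscale bE.
    (* Putting B at index n turns the intersection into a cylinder over n + 1 distinct indices, to
       which independence applies. *)
    pose C1 i := if i == n then B else C i.
    have mC1 i : measurable (C1 i) by rewrite /C1; case: ifP.
    have C1E i : i \in iota 0 n -> C1 i = C i.
      by rewrite mem_iota /= add0n /C1 => /ltn_eqF ->.
    have indC := indep _ C (iota_uniq 0 n) mC. 
    rewrite [X in _ = (_ * X)%E]indC (_ : _ `&` _ =
      \bigcap_(i in [set` rcons (iota 0 n) n]) (Ys i @^-1` C1 i)); last first.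
      apply/seteqP; split => t /=.
        move=> [Ct Bt] i /=; rewrite mem_rcons inE => /predU1P[->|iI].
          by rewrite /C1 eqxx.
        by rewrite C1E//; exact: Ct.
      move=> Ct; split.
        by move=> i /= iI; rewrite -C1E//; apply: Ct; rewrite /= mem_rcons inE iI orbT.
      by have := Ct n; rewrite /= mem_rcons mem_head /C1 eqxx; apply.
    rewrite indep//; last by rewrite rcons_uniq iota_uniq mem_iota /= add0n ltnn.
    rewrite -cats1 big_cat big_seq1/= {2}/C1 eqxx muleC; congr (_ * _)%E.
    by apply: eq_big_seq => i /C1E ->.
  - by move=> _; rewrite /m1 /= /mrestr setTI ltey_eq Bfin.
have := m12 ((fun t => (\sum_(i < n) Ys i t)%R) @^-1` A).
rewrite /m1 /m2 /= /mrestr /mscale bE muleC; apply.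
pose GT : measurableType _ := g_sigma_algebraType G.
have mY i : (i < n)%N -> measurable_fun [set: GT] (Ys i : GT -> R).
  move=> iin _ C mC; rewrite setTI; apply: sub_sigma_algebra.
  exists (fun j => if j == i then C else setT).
    by move=> j; case: ifP.
  apply/seteqP; split => t /=.
    by move=> Ct j _; case: ifPn => // /eqP ->.
  by move=> /(_ i); rewrite /= mem_iota /= add0n eqxx; apply.
have mS : measurable_fun [set: GT] (fun t : GT => (\sum_(i < n) Ys i t)%R).
  by apply: measurable_sum => i; exact: mY.
by have := mS measurableT A mA; rewrite setTI.
Qed.

Lemma Rintegral_probability_cst (R : realType) (d : measure_display)
    (T : measurableType d) (P : probability T R) (r : R) :
  \int[P]_t r = r.
Proof.
rewrite Rintegral_cst// (_ : fine _ = 1) ?mulr1//.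
by rewrite [X in fine X](probability_setT P).
Qed.

Lemma Rintegral_law (R : realType) (d : measure_display)
    (T : measurableType d) (P : probability T R) (X : {RV P >-> R})
    (nu : probability R R) (f : R -> R) (M : R) :
  (forall A, measurable A -> distribution P X A = nu A) ->
  measurable_fun setT f -> (forall x, `|f x| <= M) ->
  \int[P]_t f (X t) = \int[nu]_x f x.
Proof.
move=> Xnu mf fM; congr fine.
rewrite -(@eq_measure_integral _ _ _ _ nu (distribution P X)); last first.
  by move=> A mA _; exact: Xnu.
rewrite integral_distribution//; first exact/measurable_EFinP.
by apply: (@bounded_integrable _ _ _ _ _ M) => //=;
   [rewrite probability_setT ltry|exact: measurableT_comp].
Qed.

Lemma bounded_integrableP (R : realType) (d : measure_display)
    (T : measurableType d) (P : probability T R) (f : T -> R) (M : R) :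
  measurable_fun setT f -> (forall x, `|f x| <= M) ->
  P.-integrable setT (EFin \o f).
Proof.
move=> mf fM; apply: (bounded_integrable _ mf fM).
by rewrite [X in (X < _)%E](probability_setT P) ltry.
Qed.

Lemma measurable_cosM (R : realType) (u : R) :
  measurable_fun setT (fun x : R => cos (u * x)).
Proof.
apply: (@measurableT_comp _ _ _ _ _ _ (@cos R)); last exact: measurable_funM.
by apply: continuous_measurable_fun => x; exact: continuous_cos.
Qed.

Lemma measurable_sinM (R : realType) (u : R) :
  measurable_fun setT (fun x : R => sin (u * x)).
Proof.
apply: (@measurableT_comp _ _ _ _ _ _ (@sin R)); last exact: measurable_funM.
by apply: continuous_measurable_fun => x; exact: continuous_sin.
Qed.

(** * Laplace transforms and characteristic functions of iid sums *)

Section iid_sums.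
Context (R : realType) (d : measure_display) (T : measurableType d)
  (P : probability T R) (Ys : nat -> {RV P >-> R}) (nu : probability R R).
Hypothesis indep : independent_RVs Ys.
Hypothesis law : forall i A, measurable A -> distribution P (Ys i) A = nu A.

Lemma Rintegral_sum_recr (f g : R -> R) (n : nat) (Mf Mg : R) :
  measurable_fun setT f -> measurable_fun setT g ->
  (forall x, `|f x| <= Mf) -> (forall x, `|g x| <= Mg) ->
  \int[P]_t (f (\sum_(i < n) Ys i t) * g (Ys n t)) =
  (\int[P]_t f (\sum_(i < n) Ys i t)) * \int[nu]_x g x.
Proof.
move=> mf mg fM gM.
have mS : measurable_fun setT (fun t => \sum_(i < n) Ys i t).
  by apply: measurable_sum => i.
pose S : {RV P >-> R} := HB.pack (fun t => \sum_(i < n) Ys i t)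
  (isMeasurableFun.Build _ _ _ _ _ mS).
rewrite -(@Rintegral_law _ _ _ _ (Ys n) nu g Mg)//; last exact: law.
apply: (@Rintegral_mul_indep _ _ _ P S (Ys n) f g Mf Mg) => // A B mA mB.
exact: indep_partial_sum.
Qed.

(** [nu] is a law on the whole line, so the integrand is truncated at 0 to stay bounded by 1; on the
    values of [Ys] the truncation is invisible. *)
Lemma laplace_sum (s : R) (n : nat) : 0 <= s -> (forall i t, 0 <= Ys i t) ->
  \int[P]_t expR (- (s * \sum_(i < n) Ys i t)) =
  (\int[nu]_x expR (- (s * Num.max x 0))) ^+ n.
Proof.
move=> s0 Y0; pose f (x : R) : R := expR (- (s * Num.max x 0)).
have mf : measurable_fun setT f.
  apply: measurableT_comp => //; apply: measurableT_comp => //.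
  by apply: measurable_funM => //; exact: measurable_maxr.
have fM x : `|f x| <= 1.
  rewrite ger0_norm ?expR_ge0// -expR0 ler_expR oppr_le0 mulr_ge0//.
  by rewrite le_max lexx orbT.
have fE k t : expR (- (s * \sum_(i < k) Ys i t)) = f (\sum_(i < k) Ys i t).
  by rewrite /f max_l// sumr_ge0.
elim: n => [|n IH].
  under eq_Rintegral do rewrite big_ord0 mulr0 oppr0 expR0.
  by rewrite Rintegral_probability_cst expr0.
rewrite exprSr -IH.
under [in RHS]eq_Rintegral do rewrite fE.
rewrite -(@Rintegral_sum_recr f f n 1 1)//.
apply: eq_Rintegral => t _.
rewrite big_ord_recr/= mulrDr opprD expRD fE; congr (_ * _).
by rewrite /f max_l.
Qed.

Lemma char_sum (u : R) (n : nat) :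
  (\int[P]_t cos (u * \sum_(i < n) Ys i t)) +i*
  (\int[P]_t sin (u * \sum_(i < n) Ys i t)) =
  ((\int[nu]_x cos (u * x)) +i* (\int[nu]_x sin (u * x))) ^+ n.
Proof.
pose c (x : R) : R := cos (u * x).
pose s (x : R) : R := sin (u * x).
have mc : measurable_fun setT c by exact: measurable_cosM.
have ms : measurable_fun setT s by exact: measurable_sinM.
have cM x : `|c x| <= 1 by rewrite ler_norml cos_geN1 cos_le1.
have sM x : `|s x| <= 1 by rewrite ler_norml sin_geN1 sin_le1.
have mS k : measurable_fun setT (fun t => \sum_(i < k) Ys i t).
  by apply: measurable_sum => i.
have int (f g : R -> R) k : measurable_fun setT f -> measurable_fun setT g ->
    (forall x, `|f x| <= 1) -> (forall x, `|g x| <= 1) ->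
    P.-integrable setT
      (EFin \o (fun t => f (\sum_(i < k) Ys i t) * g (Ys k t))).
  move=> mf mg fM gM; apply: (@bounded_integrableP _ _ _ _ _ (1 * 1)).
  - apply: measurable_funM; apply: measurableT_comp => //.
  - by move=> t; rewrite normrM ler_pM.
elim: n => [|n IH].
  under eq_Rintegral do rewrite big_ord0 mulr0 cos0.
  under [X in _ +i* X]eq_Rintegral do rewrite big_ord0 mulr0 sin0.
  by rewrite !Rintegral_probability_cst expr0.
rewrite exprSr -IH.
have -> : \int[P]_t cos (u * \sum_(i < n.+1) Ys i t) =
   \int[P]_t (c (\sum_(i < n) Ys i t) * c (Ys n t)) -
   \int[P]_t (s (\sum_(i < n) Ys i t) * s (Ys n t)).
  rewrite -RintegralB//; [|exact: int..].
  by apply: eq_Rintegral => t _; rewrite big_ord_recr/= mulrDr cosD.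
have -> : \int[P]_t sin (u * \sum_(i < n.+1) Ys i t) =
   \int[P]_t (s (\sum_(i < n) Ys i t) * c (Ys n t)) +
   \int[P]_t (c (\sum_(i < n) Ys i t) * s (Ys n t)).
  rewrite -RintegralD//; [|exact: int..].
  by apply: eq_Rintegral => t _; rewrite big_ord_recr/= mulrDr sinD.
rewrite !(@Rintegral_sum_recr _ _ n 1 1)//.
by rewrite [RHS]/(_ * _)/=; congr (_ +i* _); rewrite addrC.
Qed.

End iid_sums.

(** * Powers of complex numbers *)

Lemma lipschitz1_of_derive (R : realType) (f f' : R -> R) :
  (forall x : R, is_derive x 1 f (f' x)) -> (forall x, `|f' x| <= 1) ->
  forall x y, `|f x - f y| <= `|x - y|.
Proof.
move=> df f'1.
suff H x y : x < y -> `|f y - f x| <= `|y - x|.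
  move=> x y; have [xy|xy|->] := ltgtP x y; last by rewrite !subrr.
  - by rewrite distrC (distrC x); exact: H.
  - exact: H.
move=> xy; have [|c _ ->] := @MVT _ f f' x y xy (fun z _ => df z).
  apply: continuous_subspaceT => z; apply/differentiable_continuous.
  by apply/derivable1_diffP; apply: ex_derive.
by rewrite normrM ler_piMl.
Qed.

Lemma lipschitz_sin (R : realType) (x y : R) : `|sin x - sin y| <= `|x - y|.
Proof.
apply: lipschitz1_of_derive => z.
by rewrite ler_norml cos_geN1 cos_le1.
Qed.

Lemma lipschitz_cos (R : realType) (x y : R) : `|cos x - cos y| <= `|x - y|.
Proof.
apply: lipschitz1_of_derive => z.
by rewrite normrN ler_norml sin_geN1 sin_le1.
Qed.

Lemma norm_sin_le (R : realType) (x : R) : `|sin x| <= `|x|.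
Proof. by have := lipschitz_sin x 0; rewrite sin0 !subr0. Qed.

Lemma norm_cosB1_le (R : realType) (x : R) : `|1 - cos x| <= x ^+ 2.
Proof.
have -> : 1 - cos x = 2 * sin (x / 2) ^+ 2.
  by rewrite {1}(splitr x) cosD -!expr2; have := cos2Dsin2 (x / 2); lra.
have h : sin (x / 2) ^+ 2 <= (x / 2) ^+ 2.
  by rewrite -real_normK ?num_real// -[leRHS]real_normK ?num_real// lerXn2r// norm_sin_le.
rewrite ger0_norm; last by rewrite mulr_ge0// sqr_ge0.
have := sqr_ge0 x; have := h; rewrite expr_div_n; lra.
Qed.

Lemma norm_sinB_le (R : realType) (x : R) : `|x - sin x| <= x ^+ 2.
Proof.
wlog x0 : x / 0 < x => [H|].
  have [x0|x0|->] := ltgtP x 0; last by rewrite sin0 subr0 normr0 expr0n.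
  - rewrite -normrN opprB addrC -sqrrN.
    by have := H (- x); rewrite sinN opprK oppr_gt0; apply.
  - by have := H x; apply.
have [|c cI] := @MVT _ (fun z : R => z - sin z) (fun z => 1 - cos z) 0 x x0.
  apply: continuous_subspaceT => z; apply: cvgB => //; exact: continuous_sin.
rewrite sin0 !subr0 => ->.
move: cI; rewrite in_itv/= => /andP[c0 cx].
rewrite normrM expr2 (gtr0_norm x0) ler_wpM2r ?(ltW x0)//.
rewrite -cos0; apply: le_trans (lipschitz_cos _ _) _.
by rewrite sub0r normrN gtr0_norm// ltW.
Qed.

(** From 1 - x <= e^-x one gets e^x (1 - x) <= 1, while (1 - x) (1 + x + x^2) = 1 - x^3 >= 1 for x
    <= 0. *)
Lemma expR_le1Dxx (R : realType) (x : R) : x <= 0 -> expR x <= 1 + x + x ^+ 2.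
Proof.
move=> x0; have h : 1 - x <= expR (- x) by exact: expR_ge1Dx.
have e0 := expR_gt0 x; have ee : expR x * expR (- x) = 1 by rewrite expRxMexpNx_1.
have : expR x * (1 - x) <= expR x * expR (- x) by rewrite ler_wpM2l// ltW.
rewrite ee; nra.
Qed.


Lemma normc_ge0 (R : rcfType) (z : R[i]) : 0 <= normc z.
Proof. by case: z => a b; exact: sqrtr_ge0. Qed.

Lemma normc_le_add (R : rcfType) (p q : R) : normc (p +i* q) <= `|p| + `|q|.
Proof.
rewrite /= -(ler_pXn2r (n := 2))// ?nnegrE ?sqrtr_ge0 ?addr_ge0//.
rewrite sqr_sqrtr ?addr_ge0 ?sqr_ge0// sqrrD !real_normK ?num_real//.
by rewrite lerD2r lerDl mulrn_wge0// mulr_ge0.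
Qed.

Lemma norm_Re_le_normc (R : rcfType) (z : R[i]) : `|complex.Re z| <= normc z.
Proof.
case: z => a b; rewrite /= -sqrtr_sqr ler_wsqrtr//.
by rewrite lerDl sqr_ge0.
Qed.

Lemma norm_Im_le_normc (R : rcfType) (z : R[i]) : `|complex.Im z| <= normc z.
Proof.
case: z => a b; rewrite /= -sqrtr_sqr ler_wsqrtr//.
by rewrite lerDr sqr_ge0.
Qed.

(** Telescoping: exchanging one factor at a time costs at most [normc (z - v)], all powers staying
    in the unit disc. *)
Lemma normc_subX_le (R : rcfType) (z v : R[i]) (n : nat) :
  normc z <= 1 -> normc v <= 1 ->
  normc (z ^+ n - v ^+ n) <= n%:R * normc (z - v).
Proof.
move=> z1 v1; have normX k : normc (z ^+ k) <= 1.
  elim: k => [|k IH]; first by rewrite expr0 normc1.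
  by rewrite exprS normcM mulr_ile1// normc_ge0.
elim: n => [|n IH]; first by rewrite !expr0 subrr normc0 mul0r.
have -> : z ^+ n.+1 - v ^+ n.+1 = z ^+ n * (z - v) + (z ^+ n - v ^+ n) * v.
  by rewrite !exprSr; ring.
apply: le_trans (le_normcD _ _) _.
rewrite !normcM -natr1 mulrDl mul1r addrC lerD//.
  by apply: le_trans IH; rewrite ler_piMr ?normc_ge0.
by rewrite ler_piMl ?normc_ge0.
Qed.

Lemma normc_expC (R : realType) (z : R[i]) : normc (expC z) = expR (complex.Re z).
Proof.
rewrite /expC normcM /= expr0n/= addr0 sqrtr_sqr cos2Dsin2 sqrtr1 mulr1.
by rewrite ger0_norm// expR_ge0.
Qed.

Lemma expCX (R : realType) (x y : R) (n : nat) :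
  expC (x +i* y) ^+ n = expC ((n%:R * x) +i* (n%:R * y)).
Proof.
elim: n => [|n IH].
  by rewrite expr0 /expC/= !mul0r expR0 cos0 sin0 mul1r.
rewrite exprSr IH /expC/= -[LHS]/(_ * _)/=.
rewrite -natr1 !mulrDl !mul1r expRD cosD sinD.
by apply/eqP; rewrite eq_complex /=; apply/andP; split; apply/eqP; ring.
Qed.

(** Both coordinates are second-order remainders; x <= 0 keeps [expR x] at most 1, so that no
    exponential factor enters the bound. *)
Lemma normc_1DBexpC_le (R : realType) (x y : R) : x <= 0 ->
  normc (((1 + x) +i* y) - expC (x +i* y)) <= 3 * (`|x| + `|y|) ^+ 2.
Proof.
move=> x0.
have -> : ((1 + x) +i* y) - expC (x +i* y) =
    (1 + x - expR x * cos y) +i* (y - expR x * sin y).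
  by apply/eqP; rewrite eq_complex /=; apply/andP; split; apply/eqP; ring.
apply: le_trans (normc_le_add _ _) _.
have e1 : expR x <= 1 by rewrite -expR0 ler_expR.
have e0 := expR_ge0 x.
have re : `|1 + x - expR x * cos y| <= x ^+ 2 + y ^+ 2.
  have -> : 1 + x - expR x * cos y = (1 + x - expR x) + expR x * (1 - cos y).
    by ring.
  apply: le_trans (ler_normD _ _) _; apply: lerD.
    have := expR_le1Dxx x0; have := expR_ge1Dx x.
    by rewrite ler_norml => ? ?; apply/andP; split; nra.
  rewrite normrM (ger0_norm e0); apply: le_trans (norm_cosB1_le y).
  by rewrite ler_piMl.
have im : `|y - expR x * sin y| <= y ^+ 2 + `|x| * `|y|.
  have -> : y - expR x * sin y = (y - sin y) + (1 - expR x) * sin y by ring.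
  apply: le_trans (ler_normD _ _) _; apply: lerD; first exact: norm_sinB_le.
  rewrite normrM ler_pM// ?norm_sin_le//.
  rewrite ger0_norm ?subr_ge0// ler0_norm//.
  by have := expR_ge1Dx x; lra.
apply: le_trans (lerD re im) _.
rewrite -(real_normK (num_real x)) -(real_normK (num_real y)).
have := normr_ge0 x; have := normr_ge0 y; nra.
Qed.

(* Quantitative form of [(1 + w / n) ^ n ~ e ^ w]. *)
Lemma normc_powB_expC_le (R : realType) (a b : R) (n : nat) : (0 < n)%N ->
  a <= 0 -> normc ((1 + a / n%:R) +i* (b / n%:R)) <= 1 ->
  normc (((1 + a / n%:R) +i* (b / n%:R)) ^+ n - expC (a +i* b)) <=
  3 * (`|a| + `|b|) ^+ 2 / n%:R.
Proof.
move=> n0 a0 z1.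
have nR0 : 0 < n%:R :> R by rewrite ltr0n.
have an0 : a / n%:R <= 0 by rewrite pmulr_lle0// invr_gt0.
(* Both terms become n-th powers of points of the unit disc, leaving n times a remainder of order 1
   / n^2. *)
have -> : expC (a +i* b) = expC ((a / n%:R) +i* (b / n%:R)) ^+ n.
  have E (c : R) : n%:R * (c / n%:R) = c by rewrite mulrC divfK// lt0r_neq0.
  by rewrite expCX !E.
apply: le_trans (normc_subX_le _ z1 _) _.
  by rewrite normc_expC/= -[leRHS]expR0 ler_expR.
apply: le_trans (ler_wpM2l (ltW nR0) (normc_1DBexpC_le _ an0)) _.
rewrite !normrM normfV (gtr0_norm nR0) -mulrDl.
have -> : n%:R * (3 * ((`|a| + `|b|) / n%:R) ^+ 2) =
  3 * (`|a| + `|b|) ^+ 2 / n%:R by field; exact: lt0r_neq0.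
exact: lexx.
Qed.

(** * Absence of drift *)

Section drift.
Context (R : realType) (h : R -> R).
Hypothesis h_ge0 : forall x, 0 <= x -> 0 <= h x.
Hypothesis h_nd : forall x y, 0 <= x -> x <= y -> h x <= h y.
Hypothesis h_concave : forall c x, 0 <= c -> c <= 1 -> 0 <= x ->
  c * h x <= h (c * x).

(** In units of 1 / an, the point 1 / am is s = an / am. Comparing m h (1 / am), known up to the
    factor C, with the values of h at J and K traps s between J and K. By concavity h x / x is
    nonincreasing, so the defect eta observed at s carries over to J and K. *)
Lemma rescaled_scale_bound (am an m n c C J K B beta eta : R) :
  0 < am -> 0 < an -> 0 < n -> 0 < m -> 0 < c -> 0 < J -> J <= K -> eta <= 2 ->
  m <= c * n -> c * n - 1 <= m ->
  C^-1 <= m * h (1 / am) <= C -> h (2 / am) <= (2 - eta) * h (1 / am) ->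
  n * h (J / an) <= B -> c * B < C^-1 ->
  beta <= n * h (K / an) -> 0 <= beta -> C < c / 2 * beta -> 2 <= c * n ->
  n * h (2 * K / an) / K <= (2 - eta) * (n * h (J / an)) / J.
Proof.
move=> am0 an0 n0 m0 c0 J0 JK eta2 mcn cnm /andP[mh1 mh2] hh hJ cB hK beta0 Cb cn2.
have K0 : 0 < K := lt_le_trans J0 JK.
pose s := an / am.
have s0 : 0 < s by rewrite divr_gt0.
have sE : 1 / am = s / an by rewrite /s; field; rewrite !lt0r_neq0.
have s2E : 2 / am = 2 * s / an by rewrite /s; field; rewrite !lt0r_neq0.
rewrite sE in mh1 mh2; rewrite sE s2E in hh.
have div0 x : 0 <= x -> 0 <= x / an by move=> x0; rewrite divr_ge0// ltW.
(* If s < J, then m h (1 / am) would be at most c B, below its lower bound C^-1. *)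
have Js : J <= s.
  rewrite leNgt; apply/negP => sJ.
  have hle : h (s / an) <= h (J / an).
    by apply: h_nd; [exact/div0/ltW|rewrite ler_pM2r ?invr_gt0// ltW].
  have : m * h (s / an) <= c * n * h (J / an).
    by apply: ler_pM => //; [exact: ltW|exact/h_ge0/div0/ltW].
  have : c * (n * h (J / an)) <= c * B by rewrite ler_pM2l.
  by rewrite mulrA; lra.
(* If s > K, then m >= c n / 2 would make m h (1 / am) at least c beta / 2, above C. *)
have sK : s <= K.
  rewrite leNgt; apply/negP => Ks.
  have hle : h (K / an) <= h (s / an).
    by apply: h_nd; [exact/div0/ltW|rewrite ler_pM2r ?invr_gt0// ltW].
  have h1 : c * n / 2 * h (K / an) <= m * h (s / an).
    apply: ler_pM => //; first by lra.
      exact/h_ge0/div0/ltW.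
    by lra.
  have : c / 2 * beta <= c / 2 * (n * h (K / an)).
    by rewrite ler_pM2l// divr_gt0.
  lra.
have hs2 : s / K * h (2 * K / an) <= h (2 * s / an).
  have -> : 2 * s / an = s / K * (2 * K / an).
    by field; rewrite !lt0r_neq0.
  apply: h_concave; first by rewrite divr_ge0// ltW.
    by rewrite ler_pdivrMr// mul1r.
  by apply/div0; lra.
have hsJ : J / s * h (s / an) <= h (J / an).
  have -> : J / an = J / s * (s / an).
    by field; rewrite !lt0r_neq0.
  apply: h_concave; first by rewrite divr_ge0// ltW.
    by rewrite ler_pdivrMr// mul1r.
  exact/div0/ltW.
(* A chain of slopes: from 2 K down to 2 s, from 2 s to s at the price of the factor 2 - eta, from s
   down to J. *)
have key : h (2 * K / an) / K <= (2 - eta) * h (J / an) / J.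
  have hs2' : h (2 * K / an) / K <= h (2 * s / an) / s.
    by rewrite ler_pdivlMr// mulrAC -mulrA mulrC.
  have hsJ' : h (s / an) / s <= h (J / an) / J.
    by rewrite ler_pdivlMr// mulrAC -mulrA mulrC.
  apply: le_trans hs2' _; rewrite -[leRHS]mulrA.
  apply: le_trans (_ : (2 - eta) * (h (s / an) / s) <= _).
    by rewrite [leRHS]mulrA ler_pM2r ?invr_gt0.
  by apply: ler_wpM2l => //; rewrite subr_ge0.
have -> : n * h (2 * K / an) / K = n * (h (2 * K / an) / K) by rewrite mulrA.
have -> : (2 - eta) * (n * h (J / an)) / J = n * ((2 - eta) * h (J / an) / J).
  by ring.
by rewrite ler_pM2l.
Qed.

(** Let alpha be the infimum of psi s / s, assumed positive, and let J almost attain it. For n = phi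
    k, the index m near c n has its scale between J and K, which in the limit gives 2 alpha <= psi
    (2 K) / K <= (2 - eta) psi J / J, impossible for a good enough J. *)
Lemma sublinear_no_drift (a : nat -> R) (phi : nat -> nat) (psi : R -> R)
    (C eta : R) :
  (forall n, (0 < n)%N -> 0 < a n) -> 0 < C -> 0 < eta -> eta <= 1 ->
  (\forall m \near \oo, C^-1 <= m%:R * h (1 / a m) <= C) ->
  (\forall m \near \oo, h (2 / a m) <= (2 - eta) * h (1 / a m)) ->
  strictly_increasing phi ->
  (forall s, 0 < s -> (phi k)%:R * h (s / a (phi k)) @[k --> \oo] --> psi s) ->
  forall eps, 0 < eps -> exists2 s, 0 < s & psi s <= eps * s.
Proof.
move=> a0 C0 eta0 eta1 Hm1 Hm2 phi_inc Hpsi eps eps0.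
apply: contrapT => noex.
have psi_gt s : 0 < s -> eps * s < psi s.
  by move=> s0; rewrite ltNge; apply/negP => ?; apply: noex; exists s.
pose E := [set x | exists2 s, 0 < s & x = psi s / s].
have E0 : E !=set0 by exists (psi 1 / 1); exists 1.
have Elb : lbound E eps.
  by move=> _ [s s0 ->]; rewrite ler_pdivlMr//; exact/ltW/psi_gt.
have Einf : has_inf E by split => //; exists eps.
pose alpha := inf E.
have alpha0 : 0 < alpha by apply: lt_le_trans eps0 _; exact: lb_le_inf.
have alpha_le s : 0 < s -> alpha * s <= psi s.
  move=> s0; rewrite -ler_pdivlMr//; apply: ge_inf; first by exists eps.
  by exists s.
have [_ [J J0 ->] pJ] : exists2 x, E x & x < alpha + alpha * eta / 4.
  by apply: inf_adherent => //; rewrite divr_gt0// mulr_gt0.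
have psiJ0 : 0 < psi J by apply: lt_le_trans (alpha_le _ J0); rewrite mulr_gt0.
pose B := psi J + 1.
have B0 : 0 < B by rewrite addr_gt0.
(* Half of the largest c with c B <= C^-1: this excludes scales below J. *)
pose c := (2 * C * B)^-1.
have c0 : 0 < c by rewrite invr_gt0 !mulr_gt0.
have cB : c * B < C^-1.
  rewrite /c (_ : (2 * C * B)^-1 * B = C^-1 / 2); last first.
    by field; rewrite !lt0r_neq0.
  by rewrite ltr_pdivrMr// ltr_pMr ?invr_gt0// ltr1n.
clearbody c; clear psi_gt.
(* This K makes c / 2 times alpha K / 2 exceed C, which excludes scales above K. *)
pose K := J + 8 * C / (c * alpha).
have JK : J <= K by rewrite lerDl divr_ge0// ?mulr_ge0// ltW.
have K0 : 0 < K := lt_le_trans J0 JK.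
pose beta := alpha * K / 2.
have beta0 : 0 < beta by rewrite divr_gt0// mulr_gt0.
have Cbeta : C < c / 2 * beta.
  rewrite /beta /K.
  have -> : c / 2 * (alpha * (J + 8 * C / (c * alpha)) / 2) =
    c * alpha * J / 4 + 2 * C by field; rewrite !lt0r_neq0.
  have : 0 < c * alpha * J by rewrite !mulr_gt0.
  lra.
have phi_ge k : (k <= phi k)%N.
  by elim: k => // k IH; apply: leq_ltn_trans IH (phi_inc _ _ _).
have phi_oo (r : R) : \forall k \near \oo, r <= (phi k)%:R.
  near=> k; apply: le_trans (_ : k%:R <= _); last by rewrite ler_nat.
  by near: k; exact: nbhs_infty_ger.
have key : \forall k \near \oo,
  (phi k)%:R * h (2 * K / a (phi k)) / K <=
  (2 - eta) * ((phi k)%:R * h (J / a (phi k))) / J.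
  have [M1 _ HM1] := Hm1; have [M2 _ HM2] := Hm2.
  near=> k.
  (* [M1] and [M2] are the ranks from which the two eventual bounds hold; m, the integer part of c
     n, must exceed both. *)
  have cn : M1%:R + M2%:R + 2 <= c * (phi k)%:R.
    by rewrite mulrC -ler_pdivrMr//; near: k; exact: phi_oo.
  have nJ : (phi k)%:R * h (J / a (phi k)) <= B.
    by near: k; apply: (cvgr_le _ (Hpsi J J0)); rewrite ltrDl.
  have nK : beta <= (phi k)%:R * h (K / a (phi k)).
    near: k; apply: (cvgr_ge _ (Hpsi K K0)); apply: lt_le_trans (alpha_le _ K0).
    by rewrite /beta ltr_pdivrMr// ltr_pMr ?mulr_gt0// ltr1n.
  move: cn nJ nK; set n := phi k => cn nJ nK.
  have cn0 : 0 <= c * n%:R by apply: le_trans cn.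
  pose m := Num.truncn (c * n%:R).
  have /andP[m1 m2] := truncn_itv cn0.
  rewrite -/m -natr1 in m1 m2.
  have mM : (M1 + M2 < m)%N.
    by rewrite -(ltr_nat R) natrD; lra.
  have m0 : (0 < m)%N by apply: leq_ltn_trans mM.
  have n0 : (0 < n)%N.
    rewrite lt0n; apply/eqP => n0; move: cn; rewrite n0 mulr0.
    by rewrite leNgt ltr_wpDl// addr_ge0.
  apply: (@rescaled_scale_bound (a m) (a n) m%:R n%:R c C J K B beta eta) => //.
  - exact: a0.
  - exact: a0.
  - by rewrite ltr0n.
  - by rewrite ltr0n.
  - lra.
  - lra.
  - by apply: HM1; rewrite /= (leq_trans (leq_addr M2 M1))// ltnW.
  - by apply: HM2; rewrite /= (leq_trans (leq_addl M1 M2))// ltnW.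
  - exact: ltW.
  - by have := ler0n R M1; have := ler0n R M2; lra.
have K20 : 0 < 2 * K by rewrite mulr_gt0.
have lim_le : psi (2 * K) / K <= (2 - eta) * psi J / J.
  apply: ler_cvg_to key.
    by apply: cvgM; [exact: Hpsi|exact: cvg_cst].
  by apply: cvgM; [apply: cvgM; [exact: cvg_cst|exact: Hpsi]|exact: cvg_cst].
have h1 : 2 * alpha <= psi (2 * K) / K.
  by rewrite ler_pdivlMr// mulrAC [_ * alpha]mulrC; exact: alpha_le.
(* As (2 - eta) (1 + eta / 4) = 2 - eta / 2 - eta^2 / 4 < 2, this contradicts [h1]. *)
have h2 : (2 - eta) * psi J / J <= (2 - eta) * (alpha + alpha * eta / 4).
  by rewrite -mulrA ler_wpM2l ?(ltW pJ)// subr_ge0; lra.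
have : alpha * eta > 0 by rewrite mulr_gt0.
nra.
Unshelve. all: by end_near.
Qed.

End drift.

(** * Limits of profiles along an ultrafilter *)

Lemma ultra_fmap (T S : Type) (U : set_system T) (f : T -> S) :
  UltraFilter U -> UltraFilter (f @ U).
Proof.
move=> UU; split; first exact: fmap_proper_filter.
move=> G GG fUG; apply/seteqP; split => // A GA.
have [//|nA] := in_ultra_setVsetC (f @^-1` A) UU.
have GnA : G (~` A) by exact: fUG.
by have /filter_ex [? []] : G (A `&` ~` A) by exact: filterI.
Qed.

Lemma ultra_bounded_cvg (R : realType) (T : Type) (U : set_system T)
    (UU : UltraFilter U) (f : T -> R) (M : R) :
  (\forall k \near U, `|f k| <= M) -> exists l : R, f @ U --> l.
Proof.
move=> fM; have UF : UltraFilter (f @ U) by exact: ultra_fmap.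
have := @segment_compact R (- M) M; rewrite compact_ultra => /(_ _ UF) H.
have {}fM : (f @ U) `[- M, M]%classic.
  by apply: filterS fM => k; rewrite /= in_itv/= ler_norml.
by have [l [_ fl]] := H fM; exists l.
Qed.

Lemma cvg_bigsum (R : realType) (T : Type) (U : set_system T)
    (UU : Filter U) (f : nat -> T -> R) (l : nat -> R) (n : nat) :
  (forall i, f i @ U --> l i) ->
  (fun k => \sum_(i < n) f i k) @ U --> \sum_(i < n) l i.
Proof.
move=> fl; elim: n => [|n IH].
  by rewrite big_ord0; under eq_cvg do rewrite big_ord0; exact: cvg_cst.
rewrite big_ord_recr/=; under eq_cvg do rewrite big_ord_recr/=.
exact: cvgD.
Qed.

(** Along an ultrafilter, boundedness at each t gives limits at all t simultaneously; this replaces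
    the diagonal extraction and the continuity points of Helly's theorem. *)
Lemma ultra_profile_limit (R : realType) (U : set_system nat)
    (UU : UltraFilter U) (G : nat -> R -> R) :
  (forall k, nonincreasing_profile (G k)) ->
  (forall t, 0 < t -> exists C, \forall k \near U, G k t <= C) ->
  exists2 Gl : R -> R, nonincreasing_profile Gl &
    forall t, (fun k => G k t) @ U --> Gl t.
Proof.
move=> pG bG.
have cG t : exists l : R, (fun k => G k t) @ U --> l.
  have [t0|t0] := ltP 0 t.
    have [C GC] := bG t t0; apply: (@ultra_bounded_cvg _ _ _ _ _ C).
    by apply: filterS GC => k; rewrite ger0_norm//; have [_ ->] := pG k.
  exists 0; under eq_cvg do rewrite (let: And3 g0 _ _ := pG _ in g0 t t0).
  exact: cvg_cst.
have [Gl GlP] := choice cG; exists Gl => //; split => [t t0|t|s t s0 st].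
- apply: (cvg_unique _ (GlP t)); first exact: Rhausdorff.
  rewrite /=.
  under eq_cvg do rewrite (let: And3 g0 _ _ := pG _ in g0 t t0).
  exact: cvg_cst.
- apply: (cvgr_to_ge (GlP t)); apply: nearW => k.
  by have [_ ->] := pG k.
- apply: (ler_cvg_to (GlP t) (GlP s)); apply: nearW => k.
  by have [_ _ ->] := pG k.
Qed.

(** * Riemann sums of Lipschitz functions of profiles *)

Section profile_integral.
Context (R : realType) (f : R -> R) (L M : R).
Hypothesis f_meas : measurable_fun setT f.
Hypothesis f_lip : forall x y, `|f x - f y| <= L * `|x - y|.
Hypothesis f_bnd : forall x, `|f x| <= M.
Local Notation leb := (@lebesgue_measure R).

Lemma bounded_integrable_itv (g : R -> R) (a b N : R) :
  measurable_fun setT g -> (forall x, `|g x| <= N) ->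
  leb.-integrable `]a, b] (EFin \o g).
Proof.
move=> mg gN; apply: measurable_bounded_integrable => //.
- by rewrite /= lebesgue_measure_itv/=; case: ifP => _; rewrite ?ltry// -EFinD ltry.
- exact: measurable_funTS.
exists N; split; first by rewrite num_real.
by move=> x Mx y _; apply: le_trans (gN _) (ltW Mx).
Qed.

Lemma measurable_comp_profile (G : R -> R) :
  nonincreasing_profile G -> measurable_fun setT (f \o G).
Proof.
move=> pG; apply: measurableT_comp => //.
exact: measurable_nonincreasing_profile.
Qed.

Lemma profile_integrable_itv (G : R -> R) (a b : R) :
  nonincreasing_profile G -> leb.-integrable `]a, b] (EFin \o (f \o G)).
Proof.
move=> pG; apply: (@bounded_integrable_itv _ _ _ M) => //.
  exact: measurable_comp_profile.
by move=> x; exact: f_bnd.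
Qed.

Lemma Rintegral_itv_cst (a b r : R) : a <= b ->
  \int[leb]_(t in `]a, b]) r = r * (b - a).
Proof.
move=> ab; rewrite Rintegral_cst//= lebesgue_measure_itv/= lte_fin.
case: ifPn => [_|]; first by rewrite -EFinD.
by rewrite -leNgt => ba; rewrite (@le_anti _ _ a b) ?ab// subrr.
Qed.

Lemma riemann_profile_step (G : R -> R) (a b : R) :
  nonincreasing_profile G -> 0 < a -> a <= b -> 0 <= L ->
  `|\int[leb]_(t in `]a, b]) f (G t) - (b - a) * f (G a)| <=
  L * (b - a) * (G a - G b).
Proof.
move=> pG a0 ab L0; have [_ _ G_ni] := pG.
have icst r : leb.-integrable `]a, b] (EFin \o (fun=> r : R)).
  exact: (@bounded_integrable_itv _ _ _ `|r|).
pose g t := f (G t) - f (G a).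
have mg : measurable_fun setT g.
  by apply: measurable_funB => //; exact: measurable_comp_profile.
have gM t : `|g t| <= M + M by apply: le_trans (ler_normB _ _) _; exact: lerD.
have ig := bounded_integrable_itv a b mg gM.
have ig' : leb.-integrable `]a, b] (EFin \o (fun t => `|g t|)).
  apply: (@bounded_integrable_itv _ _ _ (M + M)).
    exact: measurableT_comp.
  by move=> t; rewrite normr_id.
rewrite [(b - a) * _]mulrC -(Rintegral_itv_cst (f (G a)) ab) -RintegralB//; last first.
  exact: profile_integrable_itv.
apply: le_trans (le_normr_Rintegral _ ig) _ => //.
rewrite mulrAC -(Rintegral_itv_cst (L * (G a - G b)) ab).
apply: le_Rintegral => //.
move=> t; rewrite /= in_itv/= => /andP[at_ tb].
apply: le_trans (f_lip _ _) _; rewrite ler_wpM2l// distrC ger0_norm ?subr_ge0 ?G_ni// ?(ltW at_)//.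
by rewrite lerB// G_ni// (lt_trans a0).
Qed.

(** The oscillations of [G] over the steps telescope, so the error is uniform over all profiles with
    a common bound at a. *)
Lemma riemann_profile (G : R -> R) (a eta : R) (n : nat) :
  nonincreasing_profile G -> 0 < a -> 0 <= eta -> 0 <= L ->
  `|\int[leb]_(t in `]a, a + n%:R * eta]) f (G t) -
    \sum_(i < n) eta * f (G (a + i%:R * eta))| <=
  L * eta * (G a - G (a + n%:R * eta)).
Proof.
move=> pG a0 eta0 L0; elim: n => [|n IH].
  by rewrite mul0r addr0 big_ord0 set_itvoc0 Rintegral_set0 !subrr mulr0 normr0.
set b := a + n%:R * eta in IH *; set c := a + n.+1%:R * eta.
have ab : a <= b by rewrite lerDl mulr_ge0.
have bcE : c - b = eta by rewrite /c /b -natr1; ring.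
have bc : b <= c by rewrite -subr_ge0 bcE.
have -> : \int[leb]_(t in `]a, c]) f (G t) =
  \int[leb]_(t in `]a, b]) f (G t) + \int[leb]_(t in `]b, c]) f (G t).
  rewrite -(@Rintegral_itvB _ (f \o G) (BRight a) (BRight c) b)//.
    by rewrite addrC subrK.
  exact: profile_integrable_itv.
rewrite big_ord_recr/= -/b opprD addrACA.
apply: le_trans (ler_normD _ _) _.
have step := riemann_profile_step pG (lt_le_trans a0 ab) bc L0.
rewrite bcE in step.
have -> : L * eta * (G a - G c) = L * eta * (G a - G b) + L * eta * (G b - G c).
  by ring.
exact: lerD.
Qed.

(** Pointwise convergence is used only at finitely many nodes and at a; the Riemann error is uniform
    in k because [G k a] is eventually below [Gl a + 1]. *)
Lemma cvg_profile_itv (U : set_system nat) (UU : ProperFilter U)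
    (G : nat -> R -> R) (Gl : R -> R) (a b : R) :
  (forall k, nonincreasing_profile (G k)) -> nonincreasing_profile Gl ->
  (forall t, (fun k => G k t) @ U --> Gl t) -> 0 < a -> a <= b -> 0 <= L ->
  (fun k => \int[leb]_(t in `]a, b]) f (G k t)) @ U -->
  \int[leb]_(t in `]a, b]) f (Gl t).
Proof.
move=> pG pGl GGl a0 ab L0; apply/cvgrPdist_le => e e0.
pose C := Gl a + 1.
have [_ Gl0 _] := pGl.
have C0 : 0 < C by rewrite /C ltr_wpDl.
(* Enough nodes for the Riemann error to be at most e / 4; the two Riemann errors and the
   convergence at the nodes then total 3 e / 4. *)
pose n := (Num.truncn (L * (b - a) * C / (e / 4))).+1.
have n0 : 0 < n%:R :> R by rewrite ltr0n.
pose eta := (b - a) / n%:R.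
have eta0 : 0 <= eta by rewrite divr_ge0 ?subr_ge0.
have bE : a + n%:R * eta = b.
  by rewrite /eta mulrC divfK ?lt0r_neq0// addrC subrK.
have small : L * eta * C <= e / 4.
  have -> : L * eta * C = L * (b - a) * C / n%:R by rewrite /eta; ring.
  rewrite ler_pdivrMr// [leRHS]mulrC -ler_pdivrMr ?divr_gt0//.
  exact/ltW/truncnS_gt.
have err H : nonincreasing_profile H -> H a <= C ->
    `|\int[leb]_(t in `]a, b]) f (H t) - \sum_(i < n) eta * f (H (a + i%:R * eta))|
    <= e / 4.
  move=> pH HC; have := riemann_profile n pH a0 eta0 L0; rewrite bE => h.
  apply: (le_trans h); apply: (le_trans _ small); rewrite ler_wpM2l ?mulr_ge0//.
    by rewrite subr_ge0.
  by have [_ H0 _] := pH; apply: (le_trans _ HC); rewrite gerBl H0.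
have cs : (fun k => \sum_(i < n) eta * f (G k (a + i%:R * eta))) @ U -->
    \sum_(i < n) eta * f (Gl (a + i%:R * eta)).
  apply: (@cvg_bigsum R nat U _ (fun i k => eta * f (G k (a + i%:R * eta)))
    (fun i => eta * f (Gl (a + i%:R * eta)))) => i.
  apply: cvgM; first exact: cvg_cst.
  apply/cvgrPdist_le => d d0.
  have dL : 0 < d / (L + 1) by rewrite divr_gt0// ltr_wpDl.
  have /cvgrPdist_le/(_ _ dL) := GGl (a + i%:R * eta).
  apply: filterS => k hk; apply: le_trans (f_lip _ _) _.
  apply: le_trans (ler_wpM2l L0 hk) _.
  rewrite mulrA ler_pdivrMr ?ltr_wpDl// mulrC ler_wpM2l ?(ltW d0)//.
  by rewrite lerDl.
have e4 : 0 < e / 4 by rewrite divr_gt0.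
have h1 : Gl a <= C by rewrite /C lerDl.
have h2 : \forall k \near U, G k a <= C.
  by apply: (cvgr_le _ (GGl a)); rewrite /C ltrDl.
move/cvgrPdist_le : cs => /(_ _ e4) hs.
apply: filterS2 hs h2 => k hs h2.
have := err _ pGl h1; have := err _ (pG k) h2; move: hs.
rewrite !ler_norml => /andP[? ?] /andP[? ?] /andP[? ?].
by apply/andP; split; lra.
Qed.

End profile_integral.

(* The truncation at 0 only serves to make the function bounded and Lipschitz on
   the whole line. *)
Definition satexp (R : realType) (y : R) : R := 1 - expR (- Num.max y 0).

Section satexp.
Context (R : realType).
Implicit Types x y : R.

Lemma satexp0 : satexp (0 : R) = 0.
Proof. by rewrite /satexp maxxx oppr0 expR0 subrr. Qed.

Lemma satexp_ge0 y : 0 <= satexp y.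
Proof.
by rewrite /satexp subr_ge0 -[leRHS]expR0 ler_expR oppr_le0 le_max lexx orbT.
Qed.

Lemma satexp_le1 y : satexp y <= 1.
Proof. by rewrite /satexp gerBl expR_ge0. Qed.

Lemma satexp_norm_le1 y : `|satexp y| <= 1.
Proof. by rewrite ger0_norm ?satexp_ge0// satexp_le1. Qed.

Lemma satexp_nd x y : x <= y -> satexp x <= satexp y.
Proof.
move=> xy; rewrite /satexp lerB// ler_expR lerN2 ge_max le_max xy/=.
by rewrite le_max lexx orbT.
Qed.

Lemma satexp_gt0 y : 0 < y -> 0 < satexp y.
Proof.
by move=> y0; rewrite /satexp subr_gt0 -[ltRHS]expR0 ltr_expR oppr_lt0 lt_max y0.
Qed.

Lemma satexp_lip x y : `|satexp x - satexp y| <= 1 * `|x - y|.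
Proof.
rewrite mul1r; wlog xy : x y / x <= y => [H|].
  have [xy|/ltW yx] := leP x y; first exact: H.
  by rewrite distrC (distrC x); exact: H.
rewrite distrC (distrC x) !ger0_norm ?subr_ge0 ?satexp_nd//.
set u := Num.max x 0; set v := Num.max y 0.
have uv : v - u <= y - x.
  rewrite /u /v; have [x0|x0] := leP x 0; have [y0|y0] := leP y 0; lra.
have u0 : 0 <= u by rewrite le_max lexx orbT.
apply: le_trans uv; rewrite /satexp -/u -/v.
have -> : 1 - expR (- v) - (1 - expR (- u)) = expR (- u) * (1 - expR (u - v)).
  by rewrite mulrBr mulr1 -expRD addrA addNr add0r; ring.
have e1 : expR (- u) <= 1 by rewrite -[leRHS]expR0 ler_expR oppr_le0.
have h := expR_ge1Dx (u - v); have e0 := expR_ge0 (- u).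
have uv0 : 0 <= v - u.
  rewrite subr_ge0 /u /v ge_max le_max xy/=; by rewrite le_max lexx orbT.
have [le1|/ltW ge1] := leP (expR (u - v)) 1.
  apply: le_trans (_ : 1 - expR (u - v) <= _); last by lra.
  by rewrite ler_piMl// subr_ge0.
apply: le_trans uv0; rewrite mulr_ge0_le0// subr_le0//.
Qed.

Lemma measurable_satexp : measurable_fun setT (@satexp R).
Proof.
apply: measurable_funB => //; apply: measurableT_comp => //.
by apply: measurableT_comp => //; exact: measurable_maxr.
Qed.

(* [1 - e^-y >= y / (1 + y)] *)
Lemma satexp_ge_half y : 0 <= y -> y <= 1 -> y <= 2 * satexp y.
Proof.
move=> y0 y1; rewrite /satexp max_l//.
have h := expR_ge1Dx y; have ee := expRxMexpNx_1 y.
have e0 := expR_gt0 (- y).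
have : (1 + y) * expR (- y) <= 1 by rewrite -[leRHS]ee ler_wpM2r// ltW.
nra.
Qed.

Lemma satexp1_ge_half : 1 <= 2 * satexp (1 : R).
Proof. by apply: satexp_ge_half. Qed.

(** [satexp] is of the order of min (1, y): the Lipschitz bound serves for y <= 1, the uniform bound
    beyond. *)
Lemma lipschitz_le_satexp (f : R -> R) (L M : R) : 0 <= L -> f 0 = 0 ->
  (forall x y, `|f x - f y| <= L * `|x - y|) -> (forall x, `|f x| <= M) ->
  forall y, 0 <= y -> `|f y| <= 2 * (L + M) * satexp y.
Proof.
move=> L0 f0 fL fM y y0.
have M0 : 0 <= M by apply: le_trans (fM 0).
have [y1|y1] := leP y 1.
  have := fL y 0; rewrite f0 !subr0 (ger0_norm y0) => h.
  have s := satexp_ge_half y0 y1; apply: le_trans h _.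
  have := satexp_ge0 y; nra.
have s := satexp_nd (ltW y1); have s1 := satexp1_ge_half.
have := fM y; nra.
Qed.

Lemma satexp_concave c y : 0 <= c -> c <= 1 -> 0 <= y ->
  c * satexp y <= satexp (c * y).
Proof.
move=> c0 c1 y0; rewrite /satexp !max_l ?mulr_ge0//.
have := @convex_expR R (Itv01 c0 c1) (- y) 0.
rewrite !convRE/= !mulr0 !addr0 expR0 mulrN /unstable.onem.
lra.
Qed.

End satexp.

(** * Truncation of profile integrals to compact intervals *)

Section whole_line.
Context (R : realType).
Local Notation leb := (@lebesgue_measure R).

Lemma measurable_satexp_profile (G : R -> R) :
  nonincreasing_profile G -> measurable_fun setT (fun t => satexp (G t)).
Proof.
move=> pG; apply: measurableT_comp; first exact: measurable_satexp.
exact: measurable_nonincreasing_profile.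
Qed.

Lemma integrable_satexp_profile (G : R -> R) :
  nonincreasing_profile G -> (\int[leb]_t (satexp (G t))%:E < +oo)%E ->
  leb.-integrable setT (EFin \o (fun t => satexp (G t))).
Proof.
move=> pG Goo; apply/integrableP; split.
  by apply/measurable_EFinP; exact: measurable_satexp_profile.
under eq_integral do rewrite /= ger0_norm ?satexp_ge0//.
exact: Goo.
Qed.

Lemma integrable_profile (G f : R -> R) (D : R) :
  nonincreasing_profile G -> (\int[leb]_t (satexp (G t))%:E < +oo)%E ->
  measurable_fun setT f -> 0 <= D ->
  (forall y, 0 <= y -> `|f y| <= D * satexp y) ->
  leb.-integrable setT (EFin \o (fun t => f (G t))).
Proof.
move=> pG Goo mf D0 fD; have [_ G0 _] := pG.
have iD : leb.-integrable setT (fun t => (D * satexp (G t))%:E).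
  under [X in _.-integrable _ X]eq_fun do rewrite EFinM.
  by apply: integrableZl => //; exact: integrable_satexp_profile.
apply: (le_integrable measurableT _ _ iD).
  by apply/measurable_EFinP; exact: measurable_comp_profile.
move=> t _ /=; rewrite lee_fin; apply: le_trans (fD _ (G0 t)) _.
by rewrite ler_norm.
Qed.

(** The half-line t <= 0 contributes f 0 = 0, the piece []0, a]] at most M a by boundedness, and the
    ray beyond b at most D e by domination. *)
Lemma Rintegral_profile_near_itv (G f : R -> R) (D M a b e : R) :
  nonincreasing_profile G -> (\int[leb]_t (satexp (G t))%:E < +oo)%E ->
  measurable_fun setT f -> f 0 = 0 -> 0 <= D -> 0 < a -> a <= b ->
  (forall x, `|f x| <= M) ->
  (forall y, 0 <= y -> `|f y| <= D * satexp y) ->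
  (\int[leb]_(t in `]b, +oo[) (satexp (G t))%:E <= e%:E)%E ->
  `|\int[leb]_t f (G t) - \int[leb]_(t in `]a, b]) f (G t)| <= M * a + D * e.
Proof.
move=> pG Goo mf f0 D0 a0 ab fM fD tail; have [Gneg G0 _] := pG.
have ifG := integrable_profile pG Goo mf D0 fD.
have iS (A : set R) : measurable A -> leb.-integrable A (EFin \o (fun t => f (G t))).
  by move=> mA; apply: integrableS ifG.
have iE (A : interval R) : leb.-integrable [set` A] (EFin \o (fun t => f (G t))).
  by apply: iS; exact: measurable_itv.
have -> : \int[leb]_t f (G t) = \int[leb]_(t in [set` `]-oo, +oo[]) f (G t).
  by rewrite set_itvNyy.
rewrite -[X in X - _](subrK (\int[leb]_(t in `]-oo, a]) f (G t))).
rewrite (@Rintegral_itvB _ (fun t => f (G t)) -oo%O +oo%O a)//.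
rewrite -[X in X + _ - _](subrK (\int[leb]_(t in `]a, b]) f (G t))).
rewrite (@Rintegral_itvB _ (fun t => f (G t)) (BRight a) +oo%O b)//.
rewrite -[X in _ + X - _](subrK (\int[leb]_(t in `]-oo, 0]) f (G t))).
rewrite (@Rintegral_itvB _ (fun t => f (G t)) -oo%O (BRight a) 0)//; last first.
  by rewrite bnd_simp ltW.
have -> : \int[leb]_(t in `]-oo, 0]) f (G t) = 0.
  rewrite (@eq_Rintegral _ _ _ _ _ (fun=> 0)).
    by rewrite /Rintegral integral0.
  by move=> t; rewrite inE/= in_itv/= => /Gneg ->.
rewrite addr0 [X in X - _]addrAC addrK addrC.
apply: le_trans (ler_normD _ _) _; apply: lerD.
  apply: le_trans (le_normr_Rintegral _ (iE _)) _ => //.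
  rewrite -[a in leRHS]subr0 -Rintegral_itv_cst ?(ltW a0)//.
  apply: le_Rintegral => //.
  - apply: (@bounded_integrable_itv _ _ _ _ M).
      apply: measurableT_comp => //; exact: measurable_comp_profile.
    by move=> t; rewrite normr_id.
  - exact: (@bounded_integrable_itv _ _ _ _ `|M|).
apply: le_trans (le_normr_Rintegral _ (iE _)) _ => //.
have isG (A : set R) : measurable A -> leb.-integrable A (EFin \o (fun t => satexp (G t))).
  by move=> mA; apply: integrableS (integrable_satexp_profile pG Goo).
apply: le_trans (_ : \int[leb]_(t in `]b, +oo[) (D * satexp (G t)) <= _).
  apply: le_Rintegral => //.
  - apply: (integrableS measurableT) => //.
    apply: (@integrable_profile G (fun y => `|f y|) D) => //.
      exact: measurableT_comp.
    by move=> y y0; rewrite normr_id; exact: fD.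
  - apply: (integrableS measurableT) => //.
    apply: (@integrable_profile G (fun y => D * satexp y) D) => //.
      by apply: measurable_funM => //; exact: measurable_satexp.
    by move=> y y0; rewrite ger0_norm// mulr_ge0// satexp_ge0.
  - by move=> t _; apply: fD.
rewrite RintegralZl//; last exact: isG.
rewrite ler_wpM2l// -lee_fin; apply: le_trans tail.
by rewrite fineK//; apply: integrable_fin_num => //; exact: isG.
Qed.

End whole_line.

(** * Convergence of profile integrals along an ultrafilter *)

Section profile_convergence.
Context (R : realType) (U : set_system nat) (UU : UltraFilter U)
  (G : nat -> R -> R) (Gl : R -> R).
Local Notation leb := (@lebesgue_measure R).
Hypothesis pG : forall k, nonincreasing_profile (G k).
Hypothesis pGl : nonincreasing_profile Gl.
Hypothesis GGl : forall t, (fun k => G k t) @ U --> Gl t.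

Lemma satexp_itv_limit (a b C : R) : 0 < a -> a <= b ->
  (\forall k \near U, (\int[leb]_(t in `]a, b]) (satexp (G k t))%:E <= C%:E)%E) ->
  (\int[leb]_(t in `]a, b]) (satexp (Gl t))%:E <= C%:E)%E.
Proof.
move=> a0 ab GC.
have int H : nonincreasing_profile H ->
    (\int[leb]_(t in `]a, b]) (satexp (H t))%:E)%E \is a fin_num.
  move=> pH; apply: (integrable_fin_num (mu := leb)); first exact: measurable_itv.
  exact: (profile_integrable_itv (@measurable_satexp R) (@satexp_norm_le1 R) a b pH).
rewrite -(fineK (int _ pGl)) lee_fin.
have c := cvg_profile_itv (@measurable_satexp R) (@satexp_lip R) (@satexp_norm_le1 R)
  (@ultra_proper _ _ UU) pG pGl GGl a0 ab ler01.
apply: (cvgr_to_le c); apply: filterS GC => k.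
by rewrite -{1}(fineK (int _ (pG k))) lee_fin.
Qed.

(** An inequality of Fatou type: the bound passes to the limit on each []a, a + n]], and these
    intervals exhaust the ray. *)
Lemma satexp_ray_limit (a C : R) : 0 < a ->
  (\forall k \near U, (\int[leb]_(t in `]a, +oo[) (satexp (G k t))%:E <= C%:E)%E) ->
  (\int[leb]_(t in `]a, +oo[) (satexp (Gl t))%:E <= C%:E)%E.
Proof.
move=> a0 GC; pose F n := `]a, a + n%:R]%classic.
have F_nd : nondecreasing_seq F.
  move=> i j ij; apply/subsetPset => t; rewrite /F /= !in_itv/= => /andP[-> ti].
  by rewrite (le_trans ti)// lerD2l ler_nat.
have UF : \bigcup_n F n = `]a, +oo[%classic.
  apply/seteqP; split => t /=.
    by move=> [n _]; rewrite /F /= !in_itv/= andbT => /andP[].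
  rewrite in_itv/= andbT => at_; exists (Num.truncn (t - a)).+1 => //.
  by rewrite /F /= in_itv/= at_/= -lerBlDl; exact/ltW/truncnS_gt.
have mS H : nonincreasing_profile H -> forall A : set R,
    measurable_fun A (fun t => (satexp (H t))%:E).
  move=> pH A; apply/measurable_EFinP; apply: measurable_funTS.
  exact: measurable_satexp_profile.
have mF n : measurable (F n) by exact: measurable_itv.
have c : (\int[leb]_(t in F n) (satexp (Gl t))%:E @[n --> \oo] -->
    \int[leb]_(t in \bigcup_n F n) (satexp (Gl t))%:E)%E.
  apply: ge0_nondecreasing_set_cvg_integral => //; first by move=> n; exact: mS.
  by move=> n t _; rewrite lee_fin satexp_ge0.
rewrite -UF -(cvg_lim _ c)//; apply: lime_le; first by apply/cvg_ex; eexists; exact: c.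
apply: nearW => n; apply: satexp_itv_limit => //; first by rewrite lerDl.
apply: filterS GC => k; apply: le_trans; apply: ge0_subset_integral => //.
- exact: mS.
- by move=> t _; rewrite lee_fin satexp_ge0.
- by move=> t /=; rewrite !in_itv/= => /andP[->].
Qed.

Lemma integral_satexp_pos (H : R -> R) : nonincreasing_profile H ->
  (\int[leb]_t (satexp (H t))%:E =
   \int[leb]_(t in `]0%R, +oo[) (satexp (H t))%:E)%E.
Proof.
move=> pH; have [H0 _ _] := pH; rewrite [RHS]integral_mkcond; apply: eq_integral => t _.
rewrite /patch; case: ifPn => //; rewrite notin_setE/= in_itv/= andbT.
by move=> /negP; rewrite -leNgt => /H0 ->; rewrite satexp0.
Qed.

Lemma satexp_limit (C : R) :
  (\forall k \near U, (\int[leb]_t (satexp (G k t))%:E <= C%:E)%E) ->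
  (\int[leb]_t (satexp (Gl t))%:E <= C%:E)%E.
Proof.
move=> GC; rewrite integral_satexp_pos//; pose F n := `](n.+1%:R^-1 : R), +oo[%classic.
have F_nd : nondecreasing_seq F.
  move=> i j ij; apply/subsetPset => t; rewrite /F /= !in_itv/= !andbT.
  by apply: le_lt_trans; rewrite lef_pV2 ?posrE// ler_nat.
have UF : \bigcup_n F n = `]0, +oo[%classic.
  apply/seteqP; split => t /=.
    by move=> [n _]; rewrite /F /= !in_itv/= !andbT; apply: lt_trans.
  rewrite in_itv/= andbT => t0; exists (Num.truncn t^-1) => //.
  by rewrite /F /= in_itv/= andbT invf_plt ?posrE//; exact: truncnS_gt.
have mS H : nonincreasing_profile H -> forall A : set R,
    measurable_fun A (fun t => (satexp (H t))%:E).
  move=> pH A; apply/measurable_EFinP; apply: measurable_funTS.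
  exact: measurable_satexp_profile.
have mF n : measurable (F n) by exact: measurable_itv.
have c : (\int[leb]_(t in F n) (satexp (Gl t))%:E @[n --> \oo] -->
    \int[leb]_(t in \bigcup_n F n) (satexp (Gl t))%:E)%E.
  apply: ge0_nondecreasing_set_cvg_integral => //; first by move=> n; exact: mS.
  by move=> n t _; rewrite lee_fin satexp_ge0.
rewrite -UF -(cvg_lim _ c)//; apply: lime_le; first by apply/cvg_ex; eexists; exact: c.
apply: nearW => n; apply: satexp_ray_limit => //.
apply: filterS GC => k; apply: le_trans; apply: ge0_subset_integral => //.
- exact: mS.
- by move=> t _; rewrite lee_fin satexp_ge0.
Qed.

(** Mass can only escape to t = +oo, which the uniform smallness of the [satexp] tails prevents;
    near t = 0, boundedness of f makes []0, a]] negligible for small a. *)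
Lemma cvg_Rintegral_profile (f : R -> R) (L M C : R) :
  (\forall k \near U, (\int[leb]_t (satexp (G k t))%:E <= C%:E)%E) ->
  (forall e, 0 < e -> exists2 K, 0 < K &
    \forall k \near U, (\int[leb]_(t in `]K, +oo[) (satexp (G k t))%:E <= e%:E)%E) ->
  measurable_fun setT f -> f 0 = 0 -> 0 <= L ->
  (forall x y, `|f x - f y| <= L * `|x - y|) -> (forall x, `|f x| <= M) ->
  (fun k => \int[leb]_t f (G k t)) @ U --> \int[leb]_t f (Gl t).
Proof.
move=> GC tight mf f0 L0 fL fM.
have M0 : 0 <= M by apply: le_trans (fM 0).
pose D := 2 * (L + M).
have D0 : 0 <= D by rewrite mulr_ge0// addr_ge0.
have fD := lipschitz_le_satexp L0 f0 fL fM.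
apply/cvgrPdist_le => e e0.
(* Error budget: M a <= e / 8 and D e' <= e / 4 bound each truncation error by 3 e / 8, and e / 4 is
   left for the convergence on []a, K]]. *)
pose e' := e / (4 * (D + 1)).
have D1 : 0 < D + 1 by rewrite ltr_wpDl.
have e'0 : 0 < e' by rewrite divr_gt0// mulr_gt0.
have [K K0 tK] := tight e' e'0.
pose a := Num.min K (e / (8 * (M + 1))).
have M1 : 0 < M + 1 by rewrite ltr_wpDl.
have a0 : 0 < a by rewrite lt_min K0 divr_gt0// mulr_gt0.
have aK : a <= K by rewrite ge_min lexx.
have Ma : M * a <= e / 8.
  apply: le_trans (_ : (M + 1) * (e / (8 * (M + 1))) <= _); last first.
    rewrite le_eqVlt; apply/orP; left; apply/eqP; field.
    by rewrite lt0r_neq0.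
  by apply: ler_pM => //; [exact: ltW|rewrite lerDl|rewrite ge_min lexx orbT].
have De : D * e' <= e / 4.
  apply: le_trans (_ : (D + 1) * (e / (4 * (D + 1))) <= _); last first.
    rewrite le_eqVlt; apply/orP; left; apply/eqP; field.
    by rewrite lt0r_neq0.
  by rewrite ler_wpM2r ?(ltW e'0)// lerDl.
have err H : nonincreasing_profile H ->
    (\int[leb]_t (satexp (H t))%:E <= C%:E)%E ->
    (\int[leb]_(t in `]K, +oo[) (satexp (H t))%:E <= e'%:E)%E ->
    `|\int[leb]_t f (H t) - \int[leb]_(t in `]a, K]) f (H t)| <= e * 3 / 8.
  move=> pH HC HK.
  have := Rintegral_profile_near_itv pH (le_lt_trans HC (ltry _)) mf f0 D0 a0 aK fM fD HK.
  by move=> /le_trans; apply; lra.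
have errl := err _ pGl (satexp_limit GC) (satexp_ray_limit K0 tK).
have c := cvg_profile_itv mf fL fM (@ultra_proper _ _ UU) pG pGl GGl a0 aK L0.
have e8 : 0 < e / 4 by rewrite divr_gt0.
move/cvgrPdist_le : c => /(_ _ e8) hs.
apply: filterS3 GC tK hs => k GCk tKk hs.
have := err _ (pG k) GCk tKk; move: errl hs.
rewrite !ler_norml => /andP[? ?] /andP[? ?] /andP[? ?].
by apply/andP; split; lra.
Qed.

End profile_convergence.

(** * Weak limits *)

Lemma strictly_increasing_ge (phi : nat -> nat) (k : nat) :
  strictly_increasing phi -> (k <= phi k)%N.
Proof.
by move=> phi_inc; elim: k => // k IH; apply: leq_ltn_trans IH (phi_inc k k.+1 (ltnSn k)).
Qed.

(** If no J worked, one could choose recursively an increasing [phi] with [P k (phi k)] false for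
    every k; by monotonicity in the first argument, no subsequence of [phi] would then admit any
    J. *)
Lemma eventually_of_subsequences (P : nat -> nat -> Prop) :
  (forall i j m, (i <= j)%N -> P i m -> P j m) ->
  (forall phi, strictly_increasing phi -> exists psi, strictly_increasing psi /\
     exists J, \forall k \near \oo, P J (phi (psi k))) ->
  exists J, \forall m \near \oo, P J m.
Proof.
move=> P_mono P_sub; apply: contrapT => noJ.
have bad j N : exists m, (N <= m)%N /\ ~ P j m.
  apply: contrapT => nom; apply: noJ; exists j; exists N => // m /= Nm.
  by apply: contrapT => nP; apply: nom; exists m.
have [g gP] := choice (fun jN : nat * nat => bad jN.1 jN.2).
pose phi := fix phi k := if k is k'.+1 then g (k, (phi k').+1) else g (0%N, 0%N).
have phi_bad k : ~ P k (phi k).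
  by case: k => [|k]; [case: (gP (0, 0)%N)|case: (gP (k.+1, (phi k).+1))].
have phi_inc : strictly_increasing phi.
  apply: homo_ltn; first exact: ltn_trans.
  by move=> k; case: (gP (k.+1, (phi k).+1)).
have [psi [psi_inc [J [N _ PJ]]]] := P_sub _ phi_inc.
have psi_ge k : (k <= psi k)%N by exact: strictly_increasing_ge.
apply: (phi_bad (psi (maxn J N))).
apply: (P_mono J); first exact: leq_trans (leq_maxl _ _) (psi_ge _).
by apply: PJ; rewrite /= leq_maxr.
Qed.

Lemma cvg_inv_strictly_increasing (R : realType) (n : nat -> nat) :
  strictly_increasing n -> ((n k)%:R^-1 : R) @[k --> \oo] --> (0 : R).
Proof.
move=> n_inc.
have npos : \forall k \near \oo, 0 < (n k)%:R :> R.
  exists 1%N => // k /= k0; rewrite ltr0n; apply: leq_trans k0 _.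
  exact: strictly_increasing_ge.
apply/(gtr0_cvgV0 npos)/cvgryPge => A; near=> k.
apply: le_trans (_ : k%:R <= _).
  by near: k; exact: nbhs_infty_ger.
by rewrite ler_nat strictly_increasing_ge.
Unshelve. all: by end_near.
Qed.

(** With [Ls] = - n ln (1 - q), the inequalities q <= - ln (1 - q) <= q / (1 - q) squeeze n q
    between (1 - q) [Ls] and [Ls]; and q tends to 0, being at most [Ls] / n. *)
Lemma cvg_mul_of_cvg_pow (R : realType) (n : nat -> nat) (q : nat -> R) (l : R) :
  strictly_increasing n -> (forall k, 0 <= q k <= 1) -> 0 < l ->
  (1 - q k) ^+ n k @[k --> \oo] --> l ->
  (n k)%:R * q k @[k --> \oo] --> - ln l.
Proof.
move=> n_inc q01 l0 ql.
pose Ls k := - ln ((1 - q k) ^+ n k).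
have cL : Ls k @[k --> \oo] --> - ln l.
  apply: cvgN; apply: continuous_cvg ql; exact: continuous_ln.
have n_pos : \forall k \near \oo, (0 < n k)%N.
  exists 1%N => // k /= k0; apply: leq_trans k0 _.
  exact: strictly_increasing_ge.
(* For n > 0, q = 1 would make the power vanish, which l > 0 excludes for large k. *)
have q_lt1 : \forall k \near \oo, q k < 1.
  have pow_gt0 : \forall k \near \oo, 0 < (1 - q k) ^+ n k.
    exact: (cvgr_gt _ ql).
  apply: filterS2 n_pos pow_gt0 => k nk h.
  have /andP[_ q1] := q01 k; rewrite lt_neqAle q1 andbT.
  by apply: contraTneq h => ->; rewrite subrr expr0n eqn0Ngt nk ltxx.
have upper : \forall k \near \oo, (n k)%:R * q k <= Ls k.
  apply: filterS q_lt1 => k qk1; rewrite /Ls lnXn ?subr_gt0// -mulNrn -[(- _) *+ _]mulr_natl.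
  rewrite ler_wpM2l// lerNr; have := @le_ln1Dx _ (- q k); apply.
  by rewrite ltrN2.
have lower : \forall k \near \oo, (1 - q k) * Ls k <= (n k)%:R * q k.
  apply: filterS q_lt1 => k qk1; rewrite /Ls lnXn ?subr_gt0// -mulNrn -[(- _) *+ _]mulr_natl.
  rewrite mulrCA ler_wpM2l//.
  have q'0 : 0 < 1 - q k by rewrite subr_gt0.
  have := @le_ln1Dx _ (q k / (1 - q k)).
  have -> : 1 + q k / (1 - q k) = (1 - q k)^-1 by field; rewrite lt0r_neq0.
  have /andP[qk0 _] := q01 k.
  rewrite lnV ?posrE// => /(_ _) h.
  rewrite mulrC -ler_pdivlMr//; apply: h.
  by apply: lt_le_trans (ltrN10 R) _; rewrite divr_ge0// ltW.
have cinv := @cvg_inv_strictly_increasing R n n_inc.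
have q_to0 : q k @[k --> \oo] --> 0.
  apply: (@squeeze_cvgr _ _ _ _ (fun=> 0) (fun k => Ls k * (n k)%:R^-1)).
  - apply: filterS2 n_pos upper => k nk up; have /andP[-> _] /= := q01 k.
    by rewrite ler_pdivlMr ?ltr0n// mulrC.
  - exact: cvg_cst.
  - by rewrite -[X in _ --> X](mulr0 (- ln l)); apply: cvgM.
apply: (squeeze_cvgr _ _ cL); last first.
  have : (1 - q k) * Ls k @[k --> \oo] --> (1 - 0) * - ln l.
    by apply: cvgM => //; apply: cvgB => //; exact: cvg_cst.
  by rewrite subr0 mul1r; apply.
by apply: filterS2 lower upper => k -> ->.
Unshelve. all: by end_near.
Qed.

Section weak_limits.
Context (R : realType).

Lemma EFin_expectation (d : measure_display) (T : measurableType d)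
    (P : probability T R) (X : {RV P >-> R}) (f : R -> R) (M : R) :
  measurable_fun setT f -> (forall x, `|f x| <= M) ->
  ('E_P[f \o X] = (\int[P]_t f (X t))%R%:E)%E.
Proof.
move=> mf fM; rewrite unlock fineK//; apply: integrable_fin_num => //.
apply: (@bounded_integrableP _ _ _ _ _ M) => //.
exact: measurableT_comp.
Qed.

Lemma cvg_in_distribution_Rintegral (d : measure_display)
    (T : measurableType d) (P : probability T R) (X : nat -> {RV P >-> R})
    (d' : measure_display) (T' : measurableType d') (Q : probability T' R)
    (V : {RV Q >-> R}) (f : R -> R) (M : R) :
  cvg_in_distribution X V -> continuous f -> (forall x, `|f x| <= M) ->
  \int[P]_t f (X k t) @[k --> \oo] --> \int[Q]_t f (V t).
Proof.
move=> XV cf fM; have mf := continuous_measurable_fun cf.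
have := XV f cf (ex_intro _ M fM).
rewrite (EFin_expectation V mf fM).
under eq_cvg do rewrite (EFin_expectation (X _) mf fM).
by move/fine_cvg.
Qed.


Lemma ae_eq0_of_Rintegral (d : measure_display) (T : measurableType d)
    (P : probability T R) (f : T -> R) (M : R) :
  measurable_fun setT f -> (forall t, `|f t| <= M) -> (forall t, 0 <= f t) ->
  \int[P]_t f t = 0 -> {ae P, forall t, f t = 0}.
Proof.
move=> mf fM f0 If0.
have fint := integrable_fin_num measurableT (bounded_integrableP P mf fM).
have : (\int[P]_(t in setT) `|(f t)%:E| = 0)%E.
  under eq_integral do rewrite /= ger0_norm//.
  transitivity ((\int[P]_t f t)%:E); last by rewrite If0.
  by rewrite /Rintegral fineK.
move=> /ae_eq_integral_abs => /(_ measurableT) H.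
have := H (proj2 (measurable_EFinP _ _) mf).
by apply: filterS => t /(_ I) [].
Qed.

Lemma Rintegral_gt0 (d : measure_display) (T : measurableType d)
    (P : probability T R) (f : T -> R) (M : R) :
  measurable_fun setT f -> (forall t, `|f t| <= M) -> (forall t, 0 < f t) ->
  0 < \int[P]_t f t.
Proof.
move=> mf fM f0; rewrite lt_neqAle Rintegral_ge0 ?andbT; last first.
  by move=> t _; exact: ltW.
rewrite eq_sym; apply/negP => /eqP If0.
have H := ae_eq0_of_Rintegral mf fM (fun t => ltW (f0 t)) If0.
have : P setT = 0%E.
  apply/eqP; rewrite -measure_le0; case: H => N [mN N0 sN].
  rewrite -N0; apply: le_measure; rewrite ?inE//.
  move=> t _; apply: sN => /= ft0.
  by have := f0 t; rewrite ft0 ltxx.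
by rewrite probability_setT => /eqP; rewrite eqe oner_eq0.
Qed.

Lemma Rintegral_sqr_centered (d : measure_display) (T : measurableType d)
    (P : probability T R) (f : T -> R) (M : R) :
  measurable_fun setT f -> (forall t, `|f t| <= M) ->
  \int[P]_t (f t - \int[P]_s f s) ^+ 2 =
  \int[P]_t (f t) ^+ 2 - (\int[P]_t f t) ^+ 2.
Proof.
move=> mf fM; set m := \int[P]_t f t.
have intf := bounded_integrableP P mf fM.
have mf2 : measurable_fun setT (fun t => f t ^+ 2) by exact: measurable_funX.
have f2M t : `|f t ^+ 2| <= M ^+ 2.
  by rewrite normrX lerXn2r// nnegrE// (le_trans (normr_ge0 _) (fM t)).
have intf2 := bounded_integrableP P mf2 f2M.
have lin : P.-integrable setT (EFin \o (fun t => (2 * m) * f t)).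
  apply: (@bounded_integrableP _ _ _ _ _ (`|2 * m| * M)).
    exact: measurable_funM.
  by move=> t; rewrite normrM ler_wpM2l.
transitivity (\int[P]_t (f t ^+ 2 - (2 * m * f t - m ^+ 2))).
  by apply: eq_Rintegral => t _; ring.
have lin2 : P.-integrable setT (EFin \o (fun t => (2 * m) * f t - m ^+ 2)).
  apply: (@bounded_integrableP _ _ _ _ _ (`|2 * m| * M + `|m ^+ 2|)).
    by apply: measurable_funB => //; exact: measurable_funM.
  move=> t; apply: le_trans (ler_normB _ _) _; rewrite lerD2r.
  by rewrite normrM ler_wpM2l.
have cst : P.-integrable setT (EFin \o (fun=> m ^+ 2)).
  exact: (@bounded_integrableP _ _ _ _ _ `|m ^+ 2|).
rewrite RintegralB// RintegralB// RintegralZl// Rintegral_probability_cst -/m.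
by ring.
Qed.

Lemma sqr_Rintegral_le (d : measure_display) (T : measurableType d)
    (P : probability T R) (f : T -> R) (M : R) :
  measurable_fun setT f -> (forall t, `|f t| <= M) ->
  (\int[P]_t f t) ^+ 2 <= \int[P]_t (f t) ^+ 2.
Proof.
move=> mf fM; rewrite -subr_ge0 -(Rintegral_sqr_centered P mf fM).
by apply: Rintegral_ge0 => t _; exact: sqr_ge0.
Qed.

(** Equality would mean zero variance, hence an almost surely constant f. *)
Lemma sqr_Rintegral_lt (d : measure_display) (T : measurableType d)
    (P : probability T R) (f : T -> R) (M : R) :
  measurable_fun setT f -> (forall t, `|f t| <= M) ->
  ~ (exists c, {ae P, forall t, f t = c}) ->
  (\int[P]_t f t) ^+ 2 < \int[P]_t (f t) ^+ 2.
Proof.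
move=> mf fM nc; set m := \int[P]_t f t.
pose g t := (f t - m) ^+ 2.
have mg : measurable_fun setT g by apply: measurable_funX; exact: measurable_funB.
have g0 t : 0 <= g t by exact: sqr_ge0.
have gM t : `|g t| <= (M + `|m|) ^+ 2.
  have fmM : `|f t - m| <= M + `|m|.
    by apply: le_trans (ler_normB _ _) _; rewrite lerD2r.
  by rewrite normrX lerXn2r ?nnegrE// (le_trans (normr_ge0 _) fmM).
have Ig : \int[P]_t g t = \int[P]_t (f t) ^+ 2 - m ^+ 2.
  exact: (Rintegral_sqr_centered P mf fM).
rewrite -subr_gt0 -Ig lt_neqAle Rintegral_ge0 ?andbT//.
rewrite eq_sym; apply/negP => /eqP Ig0; apply: nc; exists m.
have := ae_eq0_of_Rintegral mg gM g0 Ig0.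
apply: filterS => t /eqP.
by rewrite /g sqrf_eq0 subr_eq0 => /eqP.
Qed.

End weak_limits.

(** * Laplace exponents *)

Section laplace_exponent.
Context (R : realType) (d : measure_display) (T : measurableType d)
  (P : probability T R).

(** For s >= 0 the integrand is e^(- s max (V, 0)): thanks to the truncation in [satexp], the test
    function is bounded and continuous even before [V] is known to be nonnegative. *)
Definition laplace_exponent (V : {RV P >-> R}) (s : R) : R :=
  - ln (\int[P]_t (1 - satexp (s * V t))).

Lemma continuous_satexpM (s : R) : continuous (fun x : R => satexp (s * x)).
Proof.
move=> x; apply/cvgrPdist_le => e e0.
have s1 : 0 < `|s| + 1 by rewrite ltr_wpDl.
have es0 : 0 < e / (`|s| + 1) by rewrite divr_gt0.
have /cvgrPdist_le/(_ _ es0) : (fun y => y) @ x --> x by exact: cvg_id.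
apply: filterS => y xy; apply: le_trans (satexp_lip _ _) _.
rewrite mul1r -mulrBr normrM.
apply: le_trans (ler_wpM2l (normr_ge0 s) xy) _.
by rewrite mulrA ler_pdivrMr// mulrC ler_wpM2l ?(ltW e0)// lerDl.
Qed.

Lemma continuous_1Bsatexp (s : R) : continuous (fun x : R => 1 - satexp (s * x)).
Proof.
by move=> x; apply: cvgB; [exact: cvg_cst|exact: continuous_satexpM].
Qed.

Lemma measurable_1Bsatexp (s : R) (V : {RV P >-> R}) :
  measurable_fun setT (fun t => 1 - satexp (s * V t)).
Proof.
have m : measurable_fun setT (fun x : R => 1 - satexp (s * x)).
  by apply: continuous_measurable_fun; exact: continuous_1Bsatexp.
exact: (measurableT_comp m).
Qed.

Lemma norm_1Bsatexp (y : R) : `|1 - satexp y| <= 1.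
Proof.
by rewrite ger0_norm ?subr_ge0 ?satexp_le1// gerBl satexp_ge0.
Qed.

Lemma satexp_lt1 (y : R) : satexp y < 1.
Proof. by rewrite /satexp gtrBl expR_gt0. Qed.

Lemma laplace_transform_gt0 (V : {RV P >-> R}) (s : R) :
  0 < \int[P]_t (1 - satexp (s * V t)).
Proof.
apply: (@Rintegral_gt0 _ _ _ _ _ 1); first exact: measurable_1Bsatexp.
  by move=> t; exact: norm_1Bsatexp.
by move=> t; rewrite subr_gt0 satexp_lt1.
Qed.

(** Continuity of the Laplace transform at 0, by dominated convergence. As [V] is finite, no mass is
    lost at infinity; this is what bounds the profiles at each t > 0. *)
Lemma laplace_exponent_small (V : {RV P >-> R}) (e : R) : 0 < e ->
  exists2 s, 0 < s & laplace_exponent V s <= e.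
Proof.
move=> e0; pose s k : R := k.+1%:R^-1.
have lim : \int[P]_t (1 - satexp (s k * V t)) @[k --> \oo] --> (1 : R).
  have mf k : measurable_fun setT (fun t => (1 - satexp (s k * V t))%:E).
    by apply/measurable_EFinP; exact: measurable_1Bsatexp.
  have intk k : (\int[P]_t (1 - satexp (s k * V t))%:E)%E =
      (\int[P]_t (1 - satexp (s k * V t)))%:E.
    rewrite /Rintegral fineK//; apply: integrable_fin_num => //.
    apply: (@bounded_integrableP _ _ _ _ _ 1); first exact: measurable_1Bsatexp.
    by move=> t; exact: norm_1Bsatexp.
  have s_to0 : s k @[k --> \oo] --> (0 : R).
    exact: cvg_harmonic.
  have pw t : (fun k => 1 - satexp (s k * V t)) @ \oo --> (1 : R).
    have c : s k * V t @[k --> \oo] --> (0 : R).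
      by rewrite -[X in _ --> X](mul0r (V t)); apply: cvgM => //; exact: cvg_cst.
    have := continuous_cvg _ (@continuous_1Bsatexp 1 0) c.
    rewrite /= mul1r satexp0 subr0 => /(_ _) h.
    have -> : (fun k => 1 - satexp (s k * V t)) =
        (fun x => 1 - satexp (1 * x)) \o (fun k => s k * V t).
      by apply/funext => k /=; rewrite mul1r.
    exact: h.
  have pwE : {ae P, forall t, setT t ->
      (1 - satexp (s k * V t))%:E @[k --> \oo] --> (1%:E : \bar R)}.
    apply: aeW => t _; apply/fine_cvgP; split; first by apply: nearW.
    exact: pw.
  have ig : P.-integrable setT (EFin \o (fun=> 1 : R)).
    exact: (@bounded_integrableP _ _ _ _ _ `|1|).
  have fg : {ae P, forall t k, setT t ->
      (`|(1 - satexp (s k * V t))%:E| <= 1%:E)%E}.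
    by apply: aeW => t k _; rewrite /= lee_fin norm_1Bsatexp.
  have [_ _] := dominated_convergence measurableT mf (measurable_cst _) pwE ig fg.
  have -> : [sequence (\int[P]_t (1 - satexp (s k * V t))%:E)%E]_k =
      (fun k => (\int[P]_t (1 - satexp (s k * V t)))%:E).
    by apply/funext => k; exact: intk.
  have -> : (\int[P]_t cst 1%:E t)%E = 1%:E.
    rewrite -[RHS](_ : (\int[P]_t (1 : R))%:E = _).
      rewrite /Rintegral fineK//; exact: integrable_fin_num.
    by rewrite Rintegral_probability_cst.
  by move=> /fine_cvg.
have clim : laplace_exponent V (s k) @[k --> \oo] --> (0 : R).
  rewrite -[X in _ --> X]oppr0 -ln1; apply: cvgN.
  by apply: continuous_cvg lim; exact: continuous_ln.
have [N _ /(_ N (leqnn N)) h] := cvgr_le _ clim _ e0.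
by exists (s N) => //; rewrite /s invr_gt0 ltr0n.
Qed.

(** Strict Cauchy-Schwarz, E (w^2) > (E w)^2, for w = e^-W, which is almost surely constant only if
    [W] is. *)
Lemma laplace_exponent_nondegenerate (W : {RV P >-> R}) :
  Defs.nondegenerate W -> {ae P, forall t, 0 <= W t} ->
  0 < laplace_exponent W 1 /\
  laplace_exponent W 2 < 2 * laplace_exponent W 1.
Proof.
move=> W_nd W0; pose w t := 1 - satexp (1 * W t).
have mw : measurable_fun setT w by exact: measurable_1Bsatexp.
have w1 t : `|w t| <= 1 by exact: norm_1Bsatexp.
have w_nc : ~ exists c, {ae P, forall t, w t = c}.
  move=> [c wc]; apply: W_nd; exists (- ln c).
  apply: filterS2 W0 wc => t Wt0; rewrite /w /satexp mul1r max_l// => <-.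
  by rewrite opprB addrC subrK expRK opprK.
have lt := sqr_Rintegral_lt mw w1 w_nc.
have w2E : \int[P]_t (w t) ^+ 2 = \int[P]_t (1 - satexp (2 * W t)).
  apply: eq_Rintegral => t _.
  rewrite /w /satexp mul1r !opprB !(addrC 1) !subrK.
  have -> : Num.max (2 * W t) 0 = 2 * Num.max (W t) 0 by rewrite maxr_pMr// mulr0.
  by rewrite -expRM_natl mulrN.
rewrite w2E in lt.
have L1 := laplace_transform_gt0 W 1; have L2 := laplace_transform_gt0 W 2.
rewrite -/w in L1.
have le1 : \int[P]_t (1 - satexp (2 * W t)) <= 1.
  rewrite -[leRHS](Rintegral_probability_cst P); apply: le_Rintegral => //.
  - apply: (@bounded_integrableP _ _ _ _ _ 1); first exact: measurable_1Bsatexp.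
    by move=> t; exact: norm_1Bsatexp.
  - exact: (@bounded_integrableP _ _ _ _ _ `|1|).
  - by move=> t _; rewrite gerBl satexp_ge0.
rewrite /laplace_exponent -/w.
move: (\int[P]_t w t) (\int[P]_t (1 - satexp (2 * W t))) lt L1 L2 le1.
move=> l1 l2 lt l1_gt0 l2_gt0 l2_le1; split.
  (* If E w >= 1, then E (w^2) > (E w)^2 >= 1 contradicts [l2_le1]. *)
  rewrite oppr_gt0 ln_lt0// l1_gt0/= ltNge; apply/negP => l1_ge1.
  by have := exprn_ege1 2 l1_ge1; rewrite leNgt (lt_le_trans lt).
have : ln (l1 ^+ 2) < ln l2 by rewrite ltr_ln ?posrE ?exprn_gt0.
by rewrite lnXn// mulr2n; lra.
Qed.

End laplace_exponent.

(** With g = 2 L1 - L2, the left side is at most 2 L1 - 7 g / 8 and the right side at least 2 L1 - g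
    / 2. *)
Lemma scale_ratio_arith (R : realFieldType) (L1 L2 j m x y : R) :
  0 <= 2 * L1 - L2 -> L1 - (2 * L1 - L2) / 8 <= m * x ->
  m * y <= L2 + (2 * L1 - L2) / 8 -> j * (m * x) <= (2 * L1 - L2) / 4 ->
  m * y <= (2 - j) * (m * x).
Proof. by move: (m * x) (m * y) => u v; rewrite mulrBl; lra. Qed.

(** * Laplace exponents of normalized nonnegative sums *)

Section nonnegative_sums.
Context (R : realType) (d : measure_display) (T : measurableType d)
  (P : probability T R) (Zs : nat -> {RV P >-> R}) (nu : probability R R)
  (a : nat -> R).
Hypothesis indep : independent_RVs Zs.
Hypothesis law : forall i A, measurable A -> distribution P (Zs i) A = nu A.
Hypothesis Z0 : forall i t, 0 <= Zs i t.
Hypothesis a_gt0 : forall n, (0 < n)%N -> 0 < a n.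

Local Notation X := (normalized_sum Zs a (fun=> 0)).
Definition tail_laplace (s : R) : R := \int[nu]_x satexp (s * x).
Local Notation h := tail_laplace.

Lemma measurable_satexpM (s : R) : measurable_fun setT (fun x : R => satexp (s * x)).
Proof. by apply: continuous_measurable_fun; exact: continuous_satexpM. Qed.

Lemma integrable_satexpM (s : R) :
  nu.-integrable setT (EFin \o (fun x => satexp (s * x))).
Proof.
apply: (@bounded_integrableP _ _ _ _ _ 1); first exact: measurable_satexpM.
by move=> x; exact: satexp_norm_le1.
Qed.

Lemma satexpM_nonpos (s x : R) : 0 <= s -> x <= 0 -> satexp (s * x) = 0.
Proof.
move=> s0 x0; rewrite /satexp max_r ?oppr0 ?expR0 ?subrr//.
by rewrite mulr_ge0_le0.
Qed.

Lemma tail_laplace_ge0 (s : R) : 0 <= h s.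
Proof. by apply: Rintegral_ge0 => x _; exact: satexp_ge0. Qed.

Lemma tail_laplace_le1 (s : R) : h s <= 1.
Proof.
rewrite -[leRHS](Rintegral_probability_cst nu); apply: le_Rintegral => //.
- exact: integrable_satexpM.
- exact: (@bounded_integrableP _ _ _ _ _ `|1|).
- by move=> x _; exact: satexp_le1.
Qed.

Lemma tail_laplace_nd (x y : R) : 0 <= x -> x <= y -> h x <= h y.
Proof.
move=> x0 xy; apply: le_Rintegral => //; try exact: integrable_satexpM.
move=> z _; have [z0|z0] := leP 0 z.
  by apply: satexp_nd; rewrite ler_wpM2r.
by rewrite satexpM_nonpos ?satexp_ge0// ltW.
Qed.

Lemma tail_laplace_concave (c x : R) : 0 <= c -> c <= 1 -> 0 <= x ->
  c * h x <= h (c * x).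
Proof.
move=> c0 c1 x0; rewrite /h -RintegralZl//; last exact: integrable_satexpM.
apply: le_Rintegral => //; try exact: integrable_satexpM.
  apply: (@bounded_integrableP _ _ _ _ _ (`|c| * 1)).
    by apply: measurable_funM => //; exact: measurable_satexpM.
  by move=> z; rewrite normrM ler_wpM2l// satexp_norm_le1.
move=> z _; rewrite -mulrA; have [z0|z0] := leP 0 z.
  by apply: satexp_concave => //; exact: mulr_ge0.
by rewrite satexpM_nonpos ?mulr0 ?satexp_ge0// ltW.
Qed.

Lemma normalized_sum_ge0 (n : nat) (t : T) : 0 <= X n t.
Proof.
rewrite /normalized_sum/= /normalized_sum_fun subr0.
case: n => [|n]; first by rewrite big_ord0 mulr0.
by rewrite mulr_ge0 ?sumr_ge0// invr_ge0 ltW// a_gt0.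
Qed.

Lemma laplace_normalized_sum (s : R) (n : nat) : 0 <= s ->
  \int[P]_t (1 - satexp (s * X n t)) = (1 - h (s / a n)) ^+ n.
Proof.
move=> s0; case: n => [|n].
  rewrite expr0; under eq_Rintegral do
    rewrite /normalized_sum/= /normalized_sum_fun big_ord0 subr0 !mulr0 satexp0 subr0.
  exact: Rintegral_probability_cst.
have an0 : 0 < a n.+1 by exact: a_gt0.
have sa0 : 0 <= s / a n.+1 by rewrite divr_ge0// ltW.
have -> : \int[P]_t (1 - satexp (s * X n.+1 t)) =
    \int[P]_t expR (- (s / a n.+1 * \sum_(i < n.+1) Zs i t)).
  apply: eq_Rintegral => t _; rewrite /satexp max_l; last first.
    by rewrite mulr_ge0// normalized_sum_ge0.
  rewrite /normalized_sum/= /normalized_sum_fun subr0 mulrA.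
  by rewrite opprB addrC subrK.
rewrite (laplace_sum indep law _ sa0 Z0); congr (_ ^+ _).
have := Rintegral_probability_cst nu 1; rewrite /h => E.
rewrite -[X in X - _]E -RintegralB//; last 2 first.
- exact: (@bounded_integrableP _ _ _ _ _ `|1|).
- exact: integrable_satexpM.
apply: eq_Rintegral => x _; rewrite /satexp opprB addrC subrK.
by rewrite maxr_pMr// mulr0.
Qed.

Lemma cvg_laplace_exponent (phi : nat -> nat) (d' : measure_display)
    (T' : measurableType d') (Q : probability T' R) (V : {RV Q >-> R}) (s : R) :
  strictly_increasing phi -> cvg_in_distribution (fun k => X (phi k)) V ->
  0 <= s ->
  (phi k)%:R * h (s / a (phi k)) @[k --> \oo] --> laplace_exponent V s.
Proof.
move=> phi_inc XV s0; apply: cvg_mul_of_cvg_pow => //.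
- by move=> k; rewrite tail_laplace_ge0 tail_laplace_le1.
- exact: laplace_transform_gt0.
under eq_cvg do rewrite -laplace_normalized_sum//.
apply: (cvg_in_distribution_Rintegral XV (@continuous_1Bsatexp R s) (M := 1)).
by move=> x; exact: norm_1Bsatexp.
Qed.

(** The test function [satexp] (- x) is bounded, continuous, zero for x >= 0 and positive for x <
    0. *)
Lemma weak_limit_ge0 (phi : nat -> nat) (d' : measure_display)
    (T' : measurableType d') (Q : probability T' R) (V : {RV Q >-> R}) :
  cvg_in_distribution (fun k => X (phi k)) V -> {ae Q, forall t, 0 <= V t}.
Proof.
move=> XV.
have c : \int[P]_t satexp (-1 * X (phi k) t) @[k --> \oo] -->
    \int[Q]_t satexp (-1 * V t).
  apply: (cvg_in_distribution_Rintegral XV (@continuous_satexpM R (-1)) (M := 1)).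
  by move=> x; exact: satexp_norm_le1.
have zero k : \int[P]_t satexp (-1 * X (phi k) t) = 0.
  under eq_Rintegral.
    move=> t _; rewrite mulN1r -[- _]mul1r satexpM_nonpos//; last first.
      by rewrite oppr_le0 normalized_sum_ge0.
    over.
  exact: Rintegral_probability_cst.
have V0 : \int[Q]_t satexp (-1 * V t) = 0.
  apply: (cvg_unique _ c); first exact: Rhausdorff.
  rewrite /=; under eq_cvg do rewrite zero; exact: cvg_cst.
have mV : measurable_fun setT (fun t => satexp (-1 * V t)).
  by apply: (measurableT_comp (@measurable_satexpM (-1))).
have := ae_eq0_of_Rintegral mV (fun t => satexp_norm_le1 _) (fun t => satexp_ge0 _) V0.
apply: filterS => t; apply: contraPP => /negP; rewrite -ltNge => Vt.
by apply/eqP; rewrite gt_eqF// satexp_gt0// mulN1r oppr_gt0.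
Qed.

(** One integer J encodes both constants of the drift argument, C = J + 1 and eta = 1 / (J + 1): the
    bounds weaken as J grows, so it suffices to obtain them along subsequences, where a
    nondegenerate limit provides them. *)
Lemma eventual_scale_bounds :
  subsequentially_nondegenerate (normalized_sum Zs a (fun=> 0)) ->
  exists J : nat, \forall m \near \oo,
    (J.+1%:R^-1 <= m%:R * h (1 / a m) <= J.+1%:R) /\
    h (2 / a m) <= (2 - J.+1%:R^-1) * h (1 / a m).
Proof.
move=> a_sub; apply: eventually_of_subsequences.
  move=> i j m ij [/andP[h1 h2] h3].
  have ij' : j.+1%:R^-1 <= i.+1%:R^-1 :> R by rewrite lef_pV2 ?posrE// ler_nat.
  split; first rewrite (le_trans ij' h1) (le_trans h2) ?ler_nat//.
  apply: le_trans h3 _; rewrite ler_wpM2r ?tail_laplace_ge0//.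
  by rewrite lerD2l lerN2.
move=> phi phi_inc.
have [psi [psi_inc [d1 [T1 [Q1 [W [W_nd XW]]]]]]] := a_sub phi phi_inc.
exists psi; split => //.
have W0 := weak_limit_ge0 XW.
have [l1 l2] := laplace_exponent_nondegenerate W_nd W0.
have pp_inc : strictly_increasing (phi \o psi).
  by move=> m n mn /=; apply: phi_inc; exact: psi_inc.
have c1 := cvg_laplace_exponent pp_inc XW ler01.
have c2 := cvg_laplace_exponent pp_inc XW (ler0n _ 2).
set L1 := laplace_exponent W 1 in l1 l2 c1.
set L2 := laplace_exponent W 2 in l2 c2.
pose g := 2 * L1 - L2.
have g0 : 0 < g by rewrite subr_gt0.
(* The three summands serve in turn for the lower bound L1 / 2, the upper bound L1 + 1 and the gap
   g. *)
pose J := (Num.truncn (L1^-1 * 2) + Num.truncn (L1 + 1) +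
  Num.truncn ((g / (4 * (L1 + 1)))^-1))%N.
have inv_le (x : R) : 0 < x -> (Num.truncn x^-1 <= J)%N -> J.+1%:R^-1 <= x.
  move=> x0 xJ; rewrite invf_ple ?posrE//; apply: le_trans (ltW (truncnS_gt _)) _.
  by rewrite ler_nat ltnS.
have J1 : J.+1%:R^-1 <= L1 / 2.
  by apply: inv_le; rewrite ?divr_gt0// invf_div mulrC /J -addnA leq_addr.
have J2 : L1 + 1 <= J.+1%:R.
  apply: le_trans (ltW (truncnS_gt _)) _.
  by rewrite ler_nat ltnS /J addnAC leq_addl.
have L1_gt0 : 0 < L1 + 1 by rewrite addr_gt0.
have J3 : J.+1%:R^-1 <= g / (4 * (L1 + 1)).
  by apply: inv_le; rewrite ?divr_gt0 ?mulr_gt0// /J leq_addl.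
exists J.
have pos : \forall k \near \oo, (0 < (phi \o psi) k)%N.
  exists 1%N => // k /= k0; apply: leq_trans k0 _.
  exact: (strictly_increasing_ge k pp_inc).
near=> k.
have e1 : L1 / 2 <= ((phi \o psi) k)%:R * h (1 / a ((phi \o psi) k)).
  by near: k; apply: (cvgr_ge _ c1); rewrite ltr_pdivrMr// ltr_pMr// ltr1n.
have e2 : ((phi \o psi) k)%:R * h (1 / a ((phi \o psi) k)) <= L1 + 1.
  by near: k; apply: (cvgr_le _ c1); rewrite ltrDl.
have e3 : L1 - g / 8 <= ((phi \o psi) k)%:R * h (1 / a ((phi \o psi) k)).
  by near: k; apply: (cvgr_ge _ c1); rewrite gtrBl divr_gt0.
have e4 : ((phi \o psi) k)%:R * h (2 / a ((phi \o psi) k)) <= L2 + g / 8.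
  by near: k; apply: (cvgr_le _ c2); rewrite ltrDl divr_gt0.
have m0 : (0 < (phi \o psi) k)%N by near: k.
move: e1 e2 e3 e4 m0; rewrite /= ; set m := phi (psi k).
set x := h (1 / a m); set y := h (2 / a m) => e1 e2 e3 e4 m0.
split; first by rewrite (le_trans J1 e1) (le_trans e2 J2).
have mR : 0 < m%:R :> R by rewrite ltr0n.
rewrite -(ler_pM2l mR) mulrCA.
have Jx : J.+1%:R^-1 * (m%:R * x) <= g / 4.
  apply: le_trans (_ : g / (4 * (L1 + 1)) * (L1 + 1) <= _).
    by apply: ler_pM => //; rewrite mulr_ge0// tail_laplace_ge0.
  rewrite le_eqVlt; apply/orP; left; apply/eqP; field.
  by rewrite lt0r_neq0// addr_gt0.
exact: (scale_ratio_arith (ltW g0) e3 e4 Jx).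
Unshelve. all: by end_near.
Qed.

Lemma laplace_exponent_no_drift (phi : nat -> nat) (d' : measure_display)
    (T' : measurableType d') (Q : probability T' R) (V : {RV Q >-> R}) :
  subsequentially_nondegenerate (normalized_sum Zs a (fun=> 0)) ->
  strictly_increasing phi -> cvg_in_distribution (fun k => X (phi k)) V ->
  forall e, 0 < e -> exists2 s, 0 < s & laplace_exponent V s <= e * s.
Proof.
move=> a_sub phi_inc XV; have [J HJ] := eventual_scale_bounds a_sub.
apply: (@sublinear_no_drift R h _ _ _ a phi _ J.+1%:R J.+1%:R^-1) => //.
- by move=> x _; exact: tail_laplace_ge0.
- by move=> x y; exact: tail_laplace_nd.
- exact: tail_laplace_concave.
- by rewrite invf_le1// ler1n.
- by apply: filterS HJ => m [].
- by apply: filterS HJ => m [].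
- by move=> s s0; apply: cvg_laplace_exponent => //; exact: ltW.
Qed.

End nonnegative_sums.

(** * Profiles of scaled laws and their tails *)

Lemma integral_mscale (R : realType) (d : measure_display)
    (T : measurableType d) (mu : {measure set T -> \bar R}) (k : {nonneg R})
    (f : T -> R) :
  mu.-integrable setT (EFin \o f) ->
  (\int[mscale k mu]_x (f x)%:E = k%:num%:E * \int[mu]_x (f x)%:E)%E.
Proof.
move=> intf; have mf := measurable_int mu intf.
have fp : (\int[mu]_x (fun y => (f y)%:E)^\+ x)%E \is a fin_num.
  by apply: integrable_fin_num => //; exact: integrable_funepos.
have fn : (\int[mu]_x (fun y => (f y)%:E)^\- x)%E \is a fin_num.
  by apply: integrable_fin_num => //; exact: integrable_funeneg.
rewrite [LHS]integralE [X in _ = (_ * X)%E]integralE.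
rewrite (@ge0_integral_mscale _ _ _ mu setT measurableT k (fun y => (f y)%:E)^\+%E)//;
  last exact: measurable_funepos.
rewrite (@ge0_integral_mscale _ _ _ mu setT measurableT k (fun y => (f y)%:E)^\-%E)//;
  last exact: measurable_funeneg.
rewrite -(fineK fp) -(fineK fn).
exact: (congr1 EFin (esym (mulrBr _ _ _))).
Qed.

Lemma scaled_tail_inverse (R : realType) (d : measure_display)
    (T : measurableType d) (P : probability T R) (Z : {RV P >-> R})
    (n : nat) (c : R) :
  (forall t, 0 <= Z t) -> 0 <= c ->
  exists2 G : R -> R, nonincreasing_profile G &
    forall (f : R -> R) (M : R), measurable_fun setT f -> f 0 = 0 ->
      (forall x, `|f x| <= M) ->
      (\int[lebesgue_measure]_t (f (G t))%:E =
        (n%:R * \int[P]_t f (c * Z t))%:E)%E.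
Proof.
move=> Z0 c0.
have mX : measurable_fun setT (fun t => c * Z t) by exact: measurable_funM.
pose X : {RV P >-> R} := HB.pack (fun t => c * Z t)
  (isMeasurableFun.Build _ _ _ _ _ mX).
pose nn : {nonneg R} := NngNum (ler0n R n).
pose m : {measure set R -> \bar R} := mscale nn (distribution P X).
have m_fin : (m setT < +oo)%E.
  by rewrite /m /= /mscale [X in (_ * X)%E](probability_setT (distribution P X)) mule1 ltry.
have [G pG GE] := tail_inverse m_fin.
exists G => // f M mf f0 fM.
rewrite (integral_tail_inverse m_fin pG GE (f := EFin \o f)); last 2 first.
- exact/measurable_EFinP.
- by rewrite /= f0.
rewrite integral_mkcond restrict_EFin.
set g := f \_ _.
have mg : measurable_fun setT g.
  have mD : measurable (`]0%R, +oo[%classic : set R) by exact: measurable_itv.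
  by apply/(measurable_restrictT f mD); exact: measurable_funTS.
have gM x : `|g x| <= M.
  rewrite /g /patch; case: ifPn => // _.
  by rewrite normr0 (le_trans (normr_ge0 _) (fM 0)).
have gX t : g (c * Z t) = f (c * Z t).
  rewrite /g /patch; case: ifPn => //.
  rewrite notin_setE/= in_itv/= andbT => /negP; rewrite -leNgt => cZ.
  by rewrite (_ : c * Z t = 0) ?f0//; apply/eqP; rewrite eq_le cZ mulr_ge0.
have intg : (distribution P X).-integrable setT (EFin \o g).
  exact: (bounded_integrableP (distribution P X) mg gM).
have mgX : measurable_fun setT (fun t => g (c * Z t)).
  exact: (measurableT_comp mg mX).
have intgX : P.-integrable setT (EFin \o (fun t => g (c * Z t))).
  exact: (bounded_integrableP P mgX (fun t => gM _)).
rewrite integral_mscale//= integral_distribution//; last exact/measurable_EFinP.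
rewrite EFinM; congr (_ * _)%E.
rewrite /= -(fineK (integrable_fin_num measurableT intgX)); congr (fine _)%:E.
by apply: eq_integral => t _; rewrite /= gX.
Qed.

(** A Markov inequality: by monotonicity, [s * H t > 1] would make the integrand at least [satexp 1]
    on all of []0, t]]. *)
Lemma profile_le_of_integral (R : realType) (H : R -> R) (s t : R) :
  nonincreasing_profile H -> 0 < s -> 0 < t ->
  (\int[lebesgue_measure]_u (satexp (s * H u))%:E < (t * satexp 1)%:E)%E ->
  s * H t <= 1.
Proof.
move=> pH s0 t0; have [_ H0 H_ni] := pH; rewrite leNgt => lt_int.
apply/negP => sH; move: lt_int; rewrite ltNge => /negP; apply.
have mS : measurable_fun setT (fun u => (satexp (s * H u))%:E).
  apply/measurable_EFinP; apply: (measurableT_comp (@measurable_satexpM R s)).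
  exact: measurable_nonincreasing_profile.
apply: le_trans (_ : \int[lebesgue_measure]_(u in `]0%R, t]) (satexp (s * H u))%:E <= _)%E;
    last first.
  apply: ge0_subset_integral => //.
  by move=> u _; rewrite lee_fin satexp_ge0.
apply: le_trans (_ : \int[lebesgue_measure]_(u in `]0%R, t]) (satexp 1)%:E <= _)%E.
  rewrite integral_cst//= lebesgue_measure_itv/= lte_fin t0 oppr0 adde0.
  by rewrite -EFinM mulrC.
apply: ge0_le_integral => //.
- by move=> u _; rewrite lee_fin satexp_ge0.
- exact: measurable_funTS.
- move=> u /=; rewrite in_itv/= => /andP[u0 ut]; rewrite lee_fin satexp_nd//.
  by rewrite (le_trans (ltW sH))// ler_wpM2l ?(ltW s0)// H_ni.
Qed.

(** Beyond K the argument s H stays at most 1, where [satexp] is at least half the identity; hence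
    [satexp (H u)] <= H u <= (2 / s) [satexp (s * H u)]. This is how sublinearity of the Laplace
    exponent controls the mass near t = +oo. *)
Lemma profile_tail_le (R : realType) (H : R -> R) (s K e : R) :
  nonincreasing_profile H -> 0 < s -> 0 < K -> s * H K <= 1 ->
  (\int[lebesgue_measure]_u (satexp (s * H u))%:E <= (e * s)%:E)%E ->
  (\int[lebesgue_measure]_(u in `]K, +oo[) (satexp (H u))%:E <= (2 * e)%:E)%E.
Proof.
move=> pH s0 K0 sK int_le; have [_ H0 H_ni] := pH.
have mS r : measurable_fun setT (fun u => (satexp (r * H u))%:E).
  apply/measurable_EFinP; apply: (measurableT_comp (@measurable_satexpM R r)).
  exact: measurable_nonincreasing_profile.
have mS1 : measurable_fun setT (fun u => (satexp (H u))%:E).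
  by apply/measurable_EFinP; exact: measurable_satexp_profile.
have c0 : 0 <= 2 / s by rewrite divr_ge0// ltW.
apply: le_trans (_ : \int[lebesgue_measure]_(u in `]K, +oo[)
   ((2 / s)%:E * (satexp (s * H u))%:E) <= _)%E.
  apply: ge0_le_integral => //.
  - by move=> u _; rewrite lee_fin satexp_ge0.
  - exact: measurable_funTS.
  - by apply: measurable_funeM; apply: measurable_funTS; exact: mS.
  - move=> u /=; rewrite in_itv/= andbT => Ku.
    rewrite -EFinM lee_fin.
    have u0 := lt_trans K0 Ku.
    have sHu : s * H u <= 1.
      by apply: le_trans sK; rewrite ler_wpM2l ?(ltW s0)// H_ni// ltW.
    have h := satexp_ge_half (mulr_ge0 (ltW s0) (H0 u)) sHu.
    have h' : satexp (H u) <= H u.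
      have := satexp_lip (H u) 0; rewrite satexp0 !subr0 mul1r (ger0_norm (H0 u)).
      by rewrite ger0_norm// satexp_ge0.
    apply: le_trans h' _; rewrite mulrAC ler_pdivlMr//.
    by rewrite mulrC.
rewrite ge0_integralZl//; last 2 first.
- by apply: measurable_funTS; exact: mS.
- by move=> u _; rewrite lee_fin satexp_ge0.
apply: le_trans (_ : (2 / s)%:E * (e * s)%:E <= _)%E.
  apply: lee_wpmul2l; first by rewrite lee_fin.
  apply: (le_trans _ int_le); apply: ge0_subset_integral => //; first exact: mS.
  by move=> u _; rewrite lee_fin satexp_ge0.
rewrite -EFinM lee_fin (_ : 2 / s * (e * s) = 2 * e)//.
by field; rewrite lt0r_neq0.
Qed.

(** * Levy representation of the limits *)

(** The error of the quantitative power estimate is of order 1 / n; comparing real and imaginary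
    parts identifies the limit without complex logarithms. *)
Lemma compound_power_limit (R : realType) (U : set_system nat)
    (UU : ProperFilter U) (n : nat -> nat) (A B C S : nat -> R) (Al Bl Cl Sl : R) :
  (\forall k \near U, (0 < n k)%N) ->
  ((n k)%:R^-1 : R) @[k --> U] --> (0 : R) ->
  (\forall k \near U, A k <= 0) ->
  (\forall k \near U, normc ((1 + A k / (n k)%:R) +i* (B k / (n k)%:R)) <= 1) ->
  (\forall k \near U,
     C k +i* S k = ((1 + A k / (n k)%:R) +i* (B k / (n k)%:R)) ^+ n k) ->
  A @ U --> Al -> B @ U --> Bl -> C @ U --> Cl -> S @ U --> Sl ->
  Cl +i* Sl = expC (Al +i* Bl).
Proof.
move=> n0 ninv A0 norm1 CS cA cB cC cS.
pose err k := 3 * (`|A k| + `|B k|) ^+ 2 * (n k)%:R^-1.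
have cerr : err @ U --> (0 : R).
  rewrite -[X in _ --> X](mulr0 (3 * (`|Al| + `|Bl|) ^+ 2)).
  apply: cvgM => //; apply: cvgM; first exact: cvg_cst.
  by rewrite expr2; under eq_cvg do rewrite expr2;
    apply: cvgM; apply: cvgD; apply: cvg_norm.
have approx : \forall k \near U,
    `|C k - expR (A k) * cos (B k)| <= err k /\
    `|S k - expR (A k) * sin (B k)| <= err k.
  apply: filterS2 (filterI n0 A0) (filterI norm1 CS) => k [nk Ak] [nk1 CSk].
  have := normc_powB_expC_le nk Ak nk1; rewrite -CSk => h.
  split; apply: le_trans h.
    apply: le_trans (norm_Re_le_normc _).
    by rewrite /expC/= mul0r subr0.
  apply: le_trans (norm_Im_le_normc _).
  by rewrite /expC/= mul0r addr0.
have cexp : (fun k => expR (A k)) @ U --> expR Al.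
  by apply: continuous_cvg cA; exact: continuous_expR.
have ccos : (fun k => cos (B k)) @ U --> cos Bl.
  by apply: continuous_cvg cB; exact: continuous_cos.
have csin : (fun k => sin (B k)) @ U --> sin Bl.
  by apply: continuous_cvg cB; exact: continuous_sin.
have lim (X Y : nat -> R) (Xl Yl : R) : X @ U --> Xl -> Y @ U --> Yl ->
    (\forall k \near U, `|X k - Y k| <= err k) -> Xl = Yl.
  move=> cX cY XY; apply/eqP; rewrite -subr_eq0 -normr_le0.
  have cXY : (fun k => `|X k - Y k| - err k) @ U --> `|Xl - Yl| - 0.
    by apply: cvgB => //; apply: cvg_norm; exact: cvgB.
  rewrite -[leLHS]subr0; apply: (cvgr_to_le cXY).
  by apply: filterS XY => k; rewrite subr_le0.
have -> : Cl = expR Al * cos Bl.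
  apply: (lim _ _ _ _ cC (cvgM cexp ccos)).
  by apply: filterS approx => k [].
have -> : Sl = expR Al * sin Bl.
  apply: (lim _ _ _ _ cS (cvgM cexp csin)).
  by apply: filterS approx => k [].
by apply/eqP; rewrite eq_complex /= !mul0r subr0 addr0 !eqxx.
Qed.

Section levy_representation.
Context (R : realType) (d : measure_display) (T : measurableType d)
  (P : probability T R) (Zs : nat -> {RV P >-> R}) (nu : probability R R)
  (a : nat -> R) (phi : nat -> nat) (d' : measure_display)
  (T' : measurableType d') (Q : probability T' R) (V : {RV Q >-> R}).
Hypothesis indep : independent_RVs Zs.
Hypothesis law : forall i A, measurable A -> distribution P (Zs i) A = nu A.
Hypothesis Z0 : forall i t, 0 <= Zs i t.
Hypothesis a_gt0 : forall n, (0 < n)%N -> 0 < a n.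
Hypothesis a_sub : subsequentially_nondegenerate (normalized_sum Zs a (fun=> 0)).
Hypothesis phi_inc : strictly_increasing phi.
Hypothesis XV : cvg_in_distribution
  (fun k => normalized_sum Zs a (fun=> 0) (phi k)) V.
Local Notation X := (normalized_sum Zs a (fun=> 0)).
Local Notation h := (tail_laplace nu).
Local Notation leb := (@lebesgue_measure R).

Lemma exists_scaled_profiles : exists G : nat -> R -> R,
  (forall k, nonincreasing_profile (G k)) /\
  forall k (f : R -> R) (M : R), measurable_fun setT f -> f 0 = 0 ->
    (forall x, `|f x| <= M) ->
    (\int[leb]_t (f (G k t))%:E =
     ((phi k)%:R * \int[nu]_x f ((a (phi k))^-1 * x))%:E)%E.
Proof.
(* The absolute value covers phi k = 0, where the sign of [a 0] is not controlled; there the factor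
   phi k makes the identity hold. *)
have ex k := scaled_tail_inverse (phi k) (Z0 0%N) (normr_ge0 (a (phi k))^-1).
have [G GP] := choice (fun k => let: ex_intro2 g p q := ex k in
  ex_intro _ g (conj p q)).
exists G; split => [k|k f M mf f0 fM]; first by have [] := GP k.
have [_ GE] := GP k; rewrite (GE f M mf f0 fM); congr (_%:E).
case: (posnP (phi k)) => [->|phik]; first by rewrite !mul0r.
congr (_ * _); rewrite gtr0_norm ?invr_gt0 ?a_gt0//.
apply: (@Rintegral_law _ _ _ _ (Zs 0%N) nu (fun x => f ((a (phi k))^-1 * x)) M).
- exact: law.
- by apply: (measurableT_comp mf); exact: measurable_funM.
- by move=> x; exact: fM.
Qed.

Lemma exists_limit_profile : exists (U : set_system nat) (G : nat -> R -> R)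
    (Gl : R -> R),
  [/\ UltraFilter U /\ \oo `<=` U,
      (forall k, nonincreasing_profile (G k)) /\ nonincreasing_profile Gl,
      (\int[leb]_t (satexp (Gl t))%:E < +oo)%E,
      (forall (f : R -> R) (L M : R), measurable_fun setT f -> f 0 = 0 -> 0 <= L ->
         (forall x y, `|f x - f y| <= L * `|x - y|) -> (forall x, `|f x| <= M) ->
         (fun k => \int[leb]_t f (G k t)) @ U --> \int[leb]_t f (Gl t)) &
      forall k (f : R -> R) (M : R), measurable_fun setT f -> f 0 = 0 ->
        (forall x, `|f x| <= M) ->
        \int[leb]_t f (G k t) =
        (phi k)%:R * \int[nu]_x f ((a (phi k))^-1 * x)].
Proof.
have [G [pG GE]] := exists_scaled_profiles.
have [U [UU ooU]] := @ultraFilterLemma nat \oo _.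
have lapE k s : (\int[leb]_t (satexp (s * G k t))%:E =
    ((phi k)%:R * h (s / a (phi k)))%:E)%E.
  rewrite (GE k (fun x => satexp (s * x)) 1).
  - by congr (_%:E); congr (_ * _); apply: eq_Rintegral => x _; rewrite mulrA.
  - exact: measurable_satexpM.
  - by rewrite mulr0 satexp0.
  - by move=> x; exact: satexp_norm_le1.
have clap s : 0 <= s -> (phi k)%:R * h (s / a (phi k)) @[k --> \oo] -->
    laplace_exponent V s.
  exact: (cvg_laplace_exponent indep law Z0 a_gt0 phi_inc XV).
have lap_lt s c : 0 < s -> laplace_exponent V s < c ->
    \forall k \near U, (\int[leb]_t (satexp (s * G k t))%:E < c%:E)%E.
  move=> s0 sc.
  have lt : \forall k \near \oo, (phi k)%:R * h (s / a (phi k)) < c.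
    exact: (cvgr_lt _ (clap s (ltW s0))).
  by apply: filterS (ooU _ lt) => k; rewrite lapE lte_fin.
have s1 : 0 < satexp (1 : R) by exact: satexp_gt0.
(* Once s is so small that the limit of n h (s / a_n) is below t [satexp 1], eventually s [G k t] <=
   1. *)
have bG t : 0 < t -> exists C, \forall k \near U, G k t <= C.
  move=> t0.
  have t1 : 0 < t * satexp 1 / 2 by rewrite divr_gt0// mulr_gt0.
  have [s s0 hs] := laplace_exponent_small V t1.
  exists s^-1; have := lap_lt s (t * satexp 1) s0.
  have lt : laplace_exponent V s < t * satexp 1.
    by apply: le_lt_trans hs _; rewrite ltr_pdivrMr// ltr_pMr ?mulr_gt0// ltr1n.
  move=> /(_ lt); apply: filterS => k /(profile_le_of_integral (pG k) s0 t0).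
  by rewrite -ler_pdivlMl// mulr1.
have [Gl pGl GGl] := ultra_profile_limit UU pG bG.
pose C := laplace_exponent V 1 + 1.
have GC : \forall k \near U, (\int[leb]_t (satexp (G k t))%:E <= C%:E)%E.
  have := lap_lt 1 C ltr01; rewrite ltrDl => /(_ ltr01).
  by apply: filterS => k; under eq_integral do rewrite mul1r; exact: ltW.
have tight e : 0 < e -> exists2 K, 0 < K &
    \forall k \near U, (\int[leb]_(t in `]K, +oo[) (satexp (G k t))%:E <= e%:E)%E.
  (* First s with Laplace exponent at most e s / 4, then K so large that eventually s [G k K] <= 1.
     Along the ultrafilter e / 4 relaxes to e / 2, which the tail estimate doubles. *)
  move=> e0; have e4 : 0 < e / 4 by rewrite divr_gt0.
  have [s s0 hs] := laplace_exponent_no_drift indep law Z0 a_gt0 a_sub phi_inc XV e4.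
  pose K := (`|laplace_exponent V s| + 1) / satexp 1.
  have K0 : 0 < K by rewrite divr_gt0// ltr_wpDl.
  exists K => //.
  have lt1 : laplace_exponent V s < K * satexp 1.
    rewrite /K divfK ?lt0r_neq0//; apply: le_lt_trans (ler_norm _) _.
    by rewrite ltrDl.
  have lt2 : laplace_exponent V s < e / 2 * s.
    apply: le_lt_trans hs _; rewrite ltr_pM2r//; lra.
  apply: filterS2 (lap_lt _ _ s0 lt1) (lap_lt _ _ s0 lt2) => k h1 h2.
  have sG := profile_le_of_integral (pG k) s0 K0 h1.
  have := profile_tail_le (pG k) s0 K0 sG (ltW h2).
  by rewrite [2 * _]mulrC divfK.
exists U, G, Gl; split => //.
- exact: le_lt_trans (satexp_limit UU pG pGl GGl GC) (ltry _).
- move=> f L M mf f0 L0 fL fM.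
  exact: (cvg_Rintegral_profile UU pG pGl GGl GC tight mf f0 L0 fL fM).
- by move=> k f M mf f0 fM; rewrite /Rintegral (GE k f M mf f0 fM).
Qed.

Lemma levy_representation : exists L : {measure set R -> \bar R},
    [/\ levy_measure L,
        L (~` `]0%R, +oo[%classic) = 0%E,
        (\int[L]_(s in `]0%R, 1%R]) s%:E < +oo)%E
      & forall u : R,
          char_fun V u =
          expC (Cintegral L `]0%R, +oo[%classic
                  (fun y => expC (0 +i* (u * y)) - 1))].
Proof.
have [U [G [Gl [[UU ooU] [pG pGl] Glfin conv GE]]]] := exists_limit_profile.
have [L L0 LE] := measure_of_profile pGl.
have [_ Gl0 _] := pGl.
(* Integrals against [L] are Lebesgue integrals along [Gl], so domination by 2 [satexp] ensures
   finiteness; min (1, y^2) and the identity cut off to []0, 1]] are both dominated in this way. *)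
have L_fin (F : R -> R) : measurable_fun setT F -> F 0 = 0 -> (forall x, 0 <= F x) ->
    (forall y, 0 <= y -> F y <= 2 * satexp y) ->
    (\int[L]_(y in `]0%R, +oo[) (F y)%:E < +oo)%E.
  move=> mF F0 F_ge0 F_le; rewrite -(LE (EFin \o F)); last 2 first.
  - exact/measurable_EFinP.
  - by rewrite /= F0.
  apply: le_lt_trans (_ : \int[leb]_t (2%:E * (satexp (Gl t))%:E) < _)%E.
    apply: ge0_le_integral => //.
    - by move=> t _; rewrite /= lee_fin.
    - by apply/measurable_EFinP; exact: measurable_comp_profile.
    - by apply: measurable_funeM; apply/measurable_EFinP; exact: measurable_satexp_profile.
    - by move=> t _; rewrite /= -EFinM lee_fin F_le.
  rewrite ge0_integralZl//; last 2 first.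
  - by apply/measurable_EFinP; exact: measurable_satexp_profile.
  - by move=> t _; rewrite lee_fin satexp_ge0.
  by rewrite lte_mul_pinfty.
have le_satexp (y : R) : 0 <= y -> Num.min 1 y <= 2 * satexp y.
  move=> y0; have [y1|y1] := leP y 1; first by rewrite satexp_ge_half.
  apply: (le_trans (satexp1_ge_half R)).
  by rewrite ler_pM2l// satexp_nd// ltW.
have mD : measurable (`]0%R, +oo[%classic : set R) by exact: measurable_itv.
exists L; split => //.
- split.
    apply/eqP; rewrite -measure_le0 -L0; apply: le_measure; rewrite ?inE//.
      exact: measurableC.
    by move=> x ->; rewrite /= in_itv/= ltxx.
  have m2 : measurable_fun setT (fun x : R => Num.min 1 (x ^+ 2)).
    by apply: measurable_minr => //; exact: measurable_funX.
  rewrite (@ge0_negligible_integral _ _ _ L setT (~` `]0%R, +oo[%classic))//.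
  - rewrite setDE setTI setCK; apply: L_fin => //.
    + by rewrite expr0n/= min_r.
    + by move=> x; rewrite le_min ler01 sqr_ge0.
    + move=> y y0; apply: (le_trans _ (le_satexp _ y0)).
      rewrite le_min ge_min lexx/=; have [y1|y1] := leP y 1.
        by rewrite ge_min expr2 ler_piMl ?orbT.
      by rewrite ge_min ltW.
  - exact: measurableC.
  - exact/measurable_EFinP.
  - by move=> x _; rewrite lee_fin le_min ler01 sqr_ge0.
- pose F (y : R) : R := if (0 < y) && (y <= 1) then y else 0.
  have FE : F = (fun y : R => y) \_ (`]0, 1]%classic : set R).
    apply/funext => y; rewrite /F /patch; case: ifPn => [yI|yI].
      by rewrite mem_set//= in_itv.
    by rewrite memNset//= in_itv; exact/negP.
  have mF : measurable_fun setT F.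
    rewrite FE; apply/(measurable_restrictT _ (measurable_itv _)).
    exact: measurable_funTS.
  have -> : (\int[L]_(s in `]0%R, 1%R]) s%:E =
      \int[L]_(s in `]0%R, +oo[) (F s)%:E)%E.
    have -> : (`]0, 1]%classic : set R) = `]0, +oo[%classic `&` `]0, 1]%classic.
      by apply/seteqP; split => y /=; rewrite !in_itv/= ?andbT;
        [move=> /[dup] /andP[] | case].
    rewrite integral_mkcondr; apply: eq_integral => y _.
    by rewrite FE restrict_EFin.
  apply: L_fin => //.
  + by rewrite /F ltxx.
  + by move=> y; rewrite /F; case: ifPn => // /andP[/ltW].
  + move=> y y0; rewrite /F; case: ifPn => [/andP[_ y1]|_].
      exact: satexp_ge_half.
    by rewrite mulr_ge0// satexp_ge0.
move=> u.
(* Real and imaginary parts of e^(iuy) - 1: bounded, Lipschitz and zero at 0, as the limit theorem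
   for profiles demands. *)
pose f1 (y : R) : R := cos (u * y) - 1.
pose f2 (y : R) : R := sin (u * y).
have mf1 : measurable_fun setT f1 by apply: measurable_funB => //; exact: measurable_cosM.
have mf2 : measurable_fun setT f2 by exact: measurable_sinM.
have f10 : f1 0 = 0 by rewrite /f1 mulr0 cos0 subrr.
have f20 : f2 0 = 0 by rewrite /f2 mulr0 sin0.
have cosM x : `|cos x| <= 1 :> R by rewrite ler_norml cos_geN1 cos_le1.
have sinM x : `|sin x| <= 1 :> R by rewrite ler_norml sin_geN1 sin_le1.
have f1M y : `|f1 y| <= 2.
  by apply: le_trans (ler_normB _ _) _; rewrite normr1 -[leRHS]/(1 + 1) lerD.
have f2M y : `|f2 y| <= 1 by exact: sinM.
have f1L x y : `|f1 x - f1 y| <= `|u| * `|x - y|.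
  rewrite /f1 opprB addrA subrK.
  by apply: le_trans (lipschitz_cos _ _) _; rewrite -mulrBr normrM.
have f2L x y : `|f2 x - f2 y| <= `|u| * `|x - y|.
  by apply: le_trans (lipschitz_sin _ _) _; rewrite -mulrBr normrM.
have expCE y : expC (0 +i* y) = cos y +i* sin y :> R[i].
  by rewrite /expC/= expR0; apply/eqP; rewrite eq_complex /= !mul1r !mul0r subr0 addr0 !eqxx.
have -> : char_fun V u =
    (\int[Q]_t cos (u * V t)) +i* (\int[Q]_t sin (u * V t)).
  rewrite /char_fun /Cintegral; congr (_ +i* _);
    by apply: eq_Rintegral => t _; rewrite expCE.
have -> : Cintegral L `]0%R, +oo[%classic (fun y => expC (0 +i* (u * y)) - 1) =
    (\int[leb]_t f1 (Gl t)) +i* (\int[leb]_t f2 (Gl t)).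
  rewrite /Cintegral; congr (_ +i* _).
    rewrite [RHS]/Rintegral (LE (EFin \o f1)); last 2 first.
    - exact/measurable_EFinP.
    - by rewrite /= f10.
    by congr fine; apply: eq_integral => y _; rewrite expCE.
  rewrite [RHS]/Rintegral (LE (EFin \o f2)); last 2 first.
  - exact/measurable_EFinP.
  - by rewrite /= f20.
  by congr fine; apply: eq_integral => y _; rewrite expCE /= subr0.
pose c k := \int[nu]_x cos (u / a (phi k) * x).
pose s k := \int[nu]_x sin (u / a (phi k) * x).
have AE k : \int[leb]_t f1 (G k t) = (phi k)%:R * (c k - 1).
  rewrite (GE k f1 2 mf1 f10 f1M); congr (_ * _).
  rewrite /c -[X in _ - X](Rintegral_probability_cst nu) -RintegralB//; last 2 first.
  - apply: (bounded_integrableP nu (measurable_cosM _) (M := 1)).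
    by move=> x; exact: cosM.
  - exact: (@bounded_integrableP _ _ _ _ _ `|1|).
  by apply: eq_Rintegral => x _; rewrite /f1 mulrA.
have BE k : \int[leb]_t f2 (G k t) = (phi k)%:R * s k.
  rewrite (GE k f2 1 mf2 f20 f2M); congr (_ * _).
  by apply: eq_Rintegral => x _; rewrite /f2 mulrA.
have phi_pos : \forall k \near U, (0 < phi k)%N.
  apply: ooU; exists 1%N => // k /= k0.
  exact: leq_trans k0 (strictly_increasing_ge k phi_inc).
have phi_inv : ((phi k)%:R^-1 : R) @[k --> U] --> (0 : R).
  apply: cvg_trans (_ : ((phi k)%:R^-1 : R) @[k --> \oo] --> (0 : R)).
    by move=> B; exact: ooU.
  exact: cvg_inv_strictly_increasing.
(* The base of the n-th power is the characteristic function of a single scaled term; its modulus is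
   at most 1 by Jensen's inequality, in [cs1]. *)
have zE k : (0 < phi k)%N ->
    ((1 + \int[leb]_t f1 (G k t) / (phi k)%:R) +i*
     (\int[leb]_t f2 (G k t) / (phi k)%:R)) = c k +i* s k.
  move=> phik; rewrite AE BE.
  have n0 : (phi k)%:R != 0 :> R by rewrite pnatr_eq0 -lt0n.
  by congr (_ +i* _); field.
have cs1 k : c k ^+ 2 + s k ^+ 2 <= 1.
  have mc := measurable_cosM (u / a (phi k)).
  have ms := measurable_sinM (u / a (phi k)).
  apply: le_trans (lerD (sqr_Rintegral_le nu mc (fun x => cosM _))
    (sqr_Rintegral_le nu ms (fun x => sinM _))) _.
  rewrite -RintegralD//; last 2 first.
  - apply: (bounded_integrableP nu (measurable_funX 2 mc) (M := 1)).
    by move=> x; rewrite normrX exprn_ile1.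
  - apply: (bounded_integrableP nu (measurable_funX 2 ms) (M := 1)).
    by move=> x; rewrite normrX exprn_ile1.
  under eq_Rintegral do rewrite cos2Dsin2.
  by rewrite Rintegral_probability_cst.
have normz k : normc (c k +i* s k) <= 1.
  by rewrite /= -[leRHS]sqrtr1 ler_wsqrtr.
have ck1 k : c k <= 1.
  by apply: (le_trans _ (normz k)); apply: (le_trans _ (norm_Re_le_normc _)); exact: ler_norm.
apply: (@compound_power_limit R U _ phi
  (fun k => \int[leb]_t f1 (G k t)) (fun k => \int[leb]_t f2 (G k t))
  (fun k => \int[P]_t cos (u * X (phi k) t))
  (fun k => \int[P]_t sin (u * X (phi k) t))) => //.
- by apply: nearW => k; rewrite AE mulr_ge0_le0// subr_le0.
- by apply: filterS phi_pos => k phik; rewrite zE.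
- apply: filterS phi_pos => k phik; rewrite zE// -(char_sum indep law).
  by congr (_ +i* _); apply: eq_Rintegral => t _;
    rewrite /normalized_sum/= /normalized_sum_fun subr0 mulrA.
- exact: (conv f1 `|u| 2).
- exact: (conv f2 `|u| 1).
- apply: cvg_trans (_ : \int[P]_t cos (u * X (phi k) t) @[k --> \oo] --> _).
    by move=> B; exact: ooU.
  apply: (cvg_in_distribution_Rintegral XV (f := fun x => cos (u * x)) (M := 1)).
    move=> x; apply: (@continuous_comp _ _ _ (fun x : R => u * x)).
      exact: mulrl_continuous.
    exact: continuous_cos.
  by move=> x; exact: cosM.
- apply: cvg_trans (_ : \int[P]_t sin (u * X (phi k) t) @[k --> \oo] --> _).
    by move=> B; exact: ooU.
  apply: (cvg_in_distribution_Rintegral XV (f := fun x => sin (u * x)) (M := 1)).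
    move=> x; apply: (@continuous_comp _ _ _ (fun x : R => u * x)).
      exact: mulrl_continuous.
    exact: continuous_sin.
  by move=> x; exact: sinM.
Qed.

End levy_representation.

(** * From almost sure to pointwise nonnegativity *)

Lemma cvg_in_distribution_ae_eq (R : realType) (d : measure_display)
    (T : measurableType d) (P : probability T R) (X X' : nat -> {RV P >-> R})
    (d' : measure_display) (T' : measurableType d') (Q : probability T' R)
    (V : {RV Q >-> R}) :
  (forall k, {ae P, forall t, X k t = X' k t}) ->
  cvg_in_distribution X V -> cvg_in_distribution X' V.
Proof.
move=> XX' XV f cf fM; have mf := continuous_measurable_fun cf.
have E k : ('E_P[f \o X' k] = 'E_P[f \o X k])%E.
  rewrite unlock; apply: ae_eq_integral => //.
  - by apply/measurable_EFinP; exact: measurableT_comp.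
  - by apply/measurable_EFinP; exact: measurableT_comp.
  - by apply: filterS (XX' k) => t /= ->.
by under eq_cvg do rewrite E; exact: XV.
Qed.

Lemma ae_copies_ge0 (R : realType) (d0 : measure_display)
    (T0 : measurableType d0) (P0 : probability T0 R) (Y : {RV P0 >-> R})
    (d : measure_display) (T : measurableType d) (P : probability T R)
    (Ys : nat -> {RV P >-> R}) :
  {ae P0, forall t, 0 <= Y t} -> iid_copies Y Ys ->
  {ae P, forall t, forall i, 0 <= Ys i t}.
Proof.
move=> Y0 [_ law]; apply/ae_foralln => i.
pose N := `]-oo, (0 : R)[%classic.
have mN : measurable N by exact: measurable_itv.
have mpre d1 (T1 : measurableType d1) (P1 : probability T1 R) (X : {RV P1 >-> R}) :
    measurable (X @^-1` N).
  by rewrite -[S in measurable S]setTI; exact: measurable_funPT.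
have YN : P0 (Y @^-1` N) = 0%E.
  have [M [mM M0 sM]] := Y0.
  apply/eqP; rewrite -measure_le0 -M0; apply: le_measure; rewrite ?inE//.
  move=> t; rewrite /N /= in_itv/= => Yt; apply: sM => /=.
  by rewrite leNgt Yt.
exists (Ys i @^-1` N); split.
- exact: mpre.
- by rewrite -YN; exact: law.
- by move=> t /= /negP; rewrite -ltNge /N /= in_itv.
Qed.

Theorem proposition1 (R : realType)
    (d0 : measure_display) (T0 : measurableType d0) (P0 : probability T0 R)
    (Y : {RV P0 >-> R})
    (Y_ge0 : {ae P0, forall t, 0 <= Y t})
    (Y_Fc : centered_feller_class Y)
    (d : measure_display) (T : measurableType d) (P : probability T R)
    (Ys : nat -> {RV P >-> R}) (Ys_iid : iid_copies Y Ys)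
    (a : nat -> R) (a_norming : norming a)
    (a_sub : subsequentially_nondegenerate (normalized_sum Ys a (fun=> 0)))
    (d' : measure_display) (T' : measurableType d') (Q : probability T' R)
    (V : {RV Q >-> R})
    (V_lim : is_subsequential_limit (normalized_sum Ys a (fun=> 0)) V) :
  exists L : {measure set R -> \bar R},
    [/\ levy_measure L,
        L (~` `]0, +oo[) = 0%E,
        (\int[L]_(s in `]0%R, 1%R]) s%:E < +oo)%E
      & forall u : R,
          char_fun V u =
          expC (Cintegral L `]0, +oo[
                  (fun y => expC (0 +i* (u * y)) - 1))].
Proof.
(* Positive parts make nonnegativity pointwise; they almost surely equal [Ys], so the normalized
   sums keep their weak limits. *)
have mZ i : measurable_fun setT (fun t => Num.max (Ys i t) 0).
  exact: measurable_maxr.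
pose Zs i : {RV P >-> R} := HB.pack (fun t => Num.max (Ys i t) 0)
  (isMeasurableFun.Build _ _ _ _ _ (mZ i)).
have [indep law] := Ys_iid.
have mmax : measurable_fun setT (fun x : R => Num.max x 0) by exact: measurable_maxr.
have mpre A : measurable A -> measurable ((fun x : R => Num.max x 0) @^-1` A).
  by move=> mA; rewrite -[X in measurable X]setTI; exact: mmax.
have Z_indep : independent_RVs Zs.
  move=> J A uJ mA.
  exact: (indep J (fun i => (fun x => Num.max x 0) @^-1` A i) uJ
    (fun i => mpre _ (mA i))).
have Z_law i A : measurable A -> distribution P (Zs i) A = distribution P (Zs 0%N) A.
  by move=> mA; rewrite [LHS](law i _ (mpre A mA)) [RHS](law 0%N _ (mpre A mA)).
have Z_ge0 i t : 0 <= Zs i t by rewrite /= le_max lexx orbT.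
have a_gt0 := a_norming.1.
have sumE n : {ae P, forall t, normalized_sum Ys a (fun=> 0) n t =
    normalized_sum Zs a (fun=> 0) n t}.
  apply: filterS (ae_copies_ge0 Y_ge0 Ys_iid) => t Yt.
  rewrite /normalized_sum /normalized_sum_fun/=; congr (_ * (_ - _)).
  by apply: eq_bigr => i _; rewrite max_l.
have Z_sub : subsequentially_nondegenerate (normalized_sum Zs a (fun=> 0)).
  move=> phi phi_inc.
  have [psi [psi_inc [d1 [T1 [Q1 [W [W_nd XW]]]]]]] := a_sub phi phi_inc.
  exists psi; split => //; exists d1, T1, Q1, W; split => //.
  by apply: cvg_in_distribution_ae_eq XW => k; exact: sumE.
have [phi [phi_inc XV]] := V_lim.
have ZV : cvg_in_distribution
    (fun k => normalized_sum Zs a (fun=> 0) (phi k)) V.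
  by apply: cvg_in_distribution_ae_eq XV => k; exact: sumE.
exact: (levy_representation Z_indep Z_law Z_ge0 a_gt0 Z_sub phi_inc ZV).
Qed.
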